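(* Let $L>0$. The skew-symmetric form $\Omega$ on $\mathcal Q_L$ given by $$\Omega_{[\gamma]}(\mathcal V,\mathcal W)=-\int_0^L \det{}_{\mathbb R}(\gamma,\gamma_x,\mathbf V,\mathbf W)\,dx ,$$ where $\mathbf V,\mathbf W\in T_\gamma\mathcal P_L$ are any representatives of $\mathcal V,\mathcal W\in T_{[\gamma]}\mathcal Q_L$, is a symplectic form on $\mathcal Q_L$ (that is, a closed, non-degenerate 2-form).
   Context: $S^3\subset\mathbb C^2$ is the set of unit vectors for the standard Hermitian inner product $\langle\cdot,\cdot\rangle$ (linear in the first slot). A regular smooth curve $\gamma:\mathbb R\to S^3$ with parameter $x$ is Legendrian if $\langle\gamma_x,\gamma\rangle=0$. $\mathcal P_L$ is the (infinite-dimensional) manifold of regular Legendrian curves that are $L$-periodic in the parameter $x$. Its tangent vectors at $\gamma$ are the vector fields along $\gamma$ of the form $\mathbf V=p\gamma_x+q(\mathrm i\gamma_x)+r(\mathrm i\gamma)$ with $p,q,r$ real-valued smooth $L$-periodic functions of $x$ and $r_x=2q\langle\gamma_x,\gamma_x\rangle$. $\mathcal Q_L$ is the quotient of $\mathcal P_L$ by the group of transformations generated by the flows of the vector fields $\mathrm i\gamma$ (rotation $\gamma\mapsto e^{\mathrm i\theta}\gamma$, $\theta$ constant) and $f(x)\gamma_x$ with $f$ any $L$-periodic function (period-preserving reparametrizations in $x$). $[\gamma]$ denotes the class of $\gamma$. A tangent vector $\mathcal V\in T_{[\gamma]}\mathcal Q_L$ is an equivalence class of elements of $T_\gamma\mathcal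 P_L$, where two are equivalent if they differ by a constant real multiple of $\mathrm i\gamma$ plus a field $f(x)\gamma_x$ with $f$ $L$-periodic; it has a unique representative of the form $\frac{r_x}{2|\gamma_x|^2}(\mathrm i\gamma_x)+r(\mathrm i\gamma)$ with $\int_0^L r\,dx=0$. $\det_{\mathbb R}$ means: identify $(z_1,z_2)^T\in\mathbb C^2$ with $(\mathrm{Re}\,z_1,\mathrm{Im}\,z_1,\mathrm{Re}\,z_2,\mathrm{Im}\,z_2)^T\in\mathbb R^4$ for each of the four vectors and take the determinant of the resulting $4\times4$ real matrix. The value of $\Omega_{[\gamma]}(\mathcal V,\mathcal W)$ does not depend on the chosen representatives. Non-degenerate means: if $\Omega_{[\gamma]}(\mathcal V,\mathcal W)=0$ for all $\mathcal V\in T_{[\gamma]}\mathcal Q_L$ then $\mathcal W=0$. *)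

(* Defs.v *)
From HB Require Import structures.
From mathcomp Require Import all_boot all_order all_algebra.
From mathcomp Require Import all_classical all_reals all_analysis.
From mathcomp Require Import complex.

Set Implicit Arguments.
Unset Strict Implicit.
Unset Printing Implicit Defensive.

Import Order.TTheory GRing.Theory Num.Theory.
Import numFieldNormedType.Exports.

Local Open Scope classical_set_scope.
Local Open Scope complex_scope.
Local Open Scope ring_scope.

(* The class S is closed under directional derivatives, so membership in such
   an S says that iterated directional derivatives of every order exist and
   are continuous; for a finite-dimensional V this is C^oo. *)
Definition smooth (R : realType) (V : normedModType R) (g : V -> R) : Prop :=
  exists2 S : set (V -> R), S g &
    forall h, S h ->
      continuous (h : V -> R^o) /\
      forall v, (forall x, derivable (h : V -> R^o) x v) /\
                S (fun x => 'D_v (h : V -> R^o) x).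

Definition smooth_periodic (R : realType) (L : R) (f : R -> R) : Prop :=
  smooth (f : R^o -> R) /\ periodic f L.

(* C^2, as column vectors (z_1, z_2)^T *)
Notation C2 R := 'cV[R[i]]_2.

(* maps R -> C^2: used both for curves and for vector fields along a curve *)
Notation curve R := (R -> C2 R).

Definition herm (R : realType) (u v : C2 R) : R[i] :=
  \sum_(k < 2) u k 0 * (v k 0)^*%C.

(* (Re z_1, Im z_1, Re z_2, Im z_2) *)
Definition realify (R : realType) (u : C2 R) : 'cV[R]_4 :=
  \col_(k < 4) [:: complex.Re (u 0 0); complex.Im (u 0 0);
                   complex.Re (u 1 0); complex.Im (u 1 0)]`_k.

Definition detR (R : realType) (a b c d : C2 R) : R :=
  \det (\matrix_(k < 4, j < 4) realify [:: a; b; c; d]`_j k 0).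

Definition smoothC2 (R : realType) (V : normedModType R) (g : V -> C2 R) :
    Prop :=
  forall k, smooth (fun x => complex.Re (g x k 0)) /\
            smooth (fun x => complex.Im (g x k 0)).

Definition derC2 (R : realType) (V : normedModType R) (v : V) (g : V -> C2 R) :
    V -> C2 R :=
  fun x => \col_k ('D_v (fun y => complex.Re (g y k 0) : R^o) x
                   +i* 'D_v (fun y => complex.Im (g y k 0) : R^o) x).

Definition dx (R : realType) (g : curve R) : curve R :=
  derC2 (V := R^o) 1 g.

Definition inP (R : realType) (L : R) (g : curve R) : Prop :=
  [/\ smoothC2 (V := R^o) g,
      forall x, g (x + L) = g x,
      forall x, herm (g x) (g x) = 1,
      forall x, dx g x != 0 &
      forall x, herm (dx g x) (g x) = 0].

Definition tangentP (R : realType) (L : R) (g V : curve R) : Prop :=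
  exists p q r : R -> R,
    [/\ smooth_periodic L p, smooth_periodic L q, smooth_periodic L r,
        forall x, (derive1 r x)%:C = 2 * (q x)%:C * herm (dx g x) (dx g x) &
        forall x, V x = (p x)%:C *: dx g x + (q x)%:C *: ('i%C *: dx g x)
                        + (r x)%:C *: ('i%C *: g x)].

Definition vertical (R : realType) (L : R) (g V : curve R) : Prop :=
  exists (a : R) (f : R -> R), smooth_periodic L f /\
    forall x, V x = a%:C *: ('i%C *: g x) + (f x)%:C *: dx g x.

(* the class in T_[g] Q_L of a vector V of T_g P_L *)
Definition tclass (R : realType) (L : R) (g V : curve R) : set (curve R) :=
  [set V' | tangentP L g V' /\ vertical L g (fun x => V' x - V x)].

(* T_[g] Q_L, seen from the representative g of [g] *)
Definition tangentQ (R : realType) (L : R) (g : curve R) :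
    set (set (curve R)) :=
  [set A | exists2 V, tangentP L g V & A = tclass L g V].

Definition is_flow (R : realType) (f : R -> R) (Phi : R -> R -> R) : Prop :=
  [/\ smooth (fun z : R^o * R^o => Phi z.1 z.2),
      forall x, Phi 0 x = x &
      forall t x, is_derive (t : R^o) 1 (fun s : R^o => Phi s x : R^o)
                            (f (Phi t x))].

(* The group generated by the flows of i g and f g_x: the time t map of the
   latter is precomposition with the time t map of the flow of f on R.  It is
   closed under inverses (take - theta, - t).  Every element acts linearly on
   maps R -> C^2, so T is also its own differential, acting on fields. *)
Inductive gauge (R : realType) (L : R) : (curve R -> curve R) -> Prop :=
| gauge_rot (theta : R) :
    gauge L (fun g x => (cos theta +i* sin theta) *: g x)
| gauge_flow (f : R -> R) (Phi : R -> R -> R) (t : R) :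
    smooth_periodic L f -> is_flow f Phi -> gauge L (fun g x => g (Phi t x))
| gauge_comp (S T : curve R -> curve R) :
    gauge L S -> gauge L T -> gauge L (fun g => S (T g)).

(* smooth n-parameter families of elements of P_L *)
Definition family (R : realType) (L : R) (n : nat)
    (G : 'rV[R]_n -> curve R) : Prop :=
  smoothC2 (fun z : 'rV[R]_n * R^o => G z.1 z.2) /\ forall s, inP L (G s).

Definition dparam (R : realType) (n : nat) (i : 'I_n) (G : 'rV[R]_n -> curve R)
    (s : 'rV[R]_n) : curve R :=
  fun x => derC2 (delta_mx 0 i) (fun s' => G s' x) s.

(* A family of skew forms om g on the spaces T_[g] Q_L.  [pullback om G j k] is
   the coefficient of ds_j /\ ds_k in the pullback of om by the map
   s |-> [G s]. *)
Definition pullback (R : realType) (L : R)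
    (om : curve R -> set (curve R) -> set (curve R) -> R) (n : nat)
    (G : 'rV[R]_n -> curve R) (j k : 'I_n) : 'rV[R]_n -> R :=
  fun s => om (G s) (tclass L (G s) (dparam j G s))
                    (tclass L (G s) (dparam k G s)).

(* Forms on Q_L are given at [g] through a representative g; [sf_invariant]
   says that the choice of g in its class is immaterial, the spaces T_[g] Q_L
   seen from g and from T g being identified by the differential of T.  Smooth
   maps into Q_L are those that locally lift to P_L, so smoothness and
   exterior derivative are tested on smooth finite-dimensional families in
   P_L; d om = 0 reads
     d_i om_jk + d_j om_ki + d_k om_ij = 0
   on the coefficients of the pullbacks. *)
Record symplectic_form (R : realType) (L : R)
    (om : curve R -> set (curve R) -> set (curve R) -> R) : Prop := {
  sf_invariant : forall T g V W, gauge L T ->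
    inP L g -> tangentP L g V -> tangentP L g W ->
    [/\ inP L (T g), tangentP L (T g) (T V), tangentP L (T g) (T W) &
        om (T g) (tclass L (T g) (T V)) (tclass L (T g) (T W)) =
        om g (tclass L g V) (tclass L g W)];
  sf_linear : forall g (a : R) V V' W,
    inP L g -> tangentP L g V -> tangentP L g V' -> tangentP L g W ->
    om g (tclass L g (fun x => a%:C *: V x + V' x)) (tclass L g W) =
    a * om g (tclass L g V) (tclass L g W)
    + om g (tclass L g V') (tclass L g W);
  sf_skew : forall g A B,
    inP L g -> tangentQ L g A -> tangentQ L g B -> om g A B = - om g B A;
  sf_smooth : forall n (G : 'rV[R]_n -> curve R) j k,
    family L G -> smooth (pullback L om G j k);
  sf_closed : forall n (G : 'rV[R]_n -> curve R) i j k s,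
    family L G ->
    'D_(delta_mx 0 i) (pullback L om G j k : 'rV[R]_n -> R^o) s
    + 'D_(delta_mx 0 j) (pullback L om G k i : 'rV[R]_n -> R^o) s
    + 'D_(delta_mx 0 k) (pullback L om G i j : 'rV[R]_n -> R^o) s = 0;
  sf_nondegenerate : forall g B, inP L g -> tangentQ L g B ->
    (forall A, tangentQ L g A -> om g A B = 0) ->
    B = tclass L g (fun=> 0)
}.

Definition OmegaP (R : realType) (L : R) (g V W : curve R) : R :=
  - (\int[lebesgue_measure]_(x in `[0, L]) detR (g x) (dx g x) (V x) (W x)).

Definition OmegaQ (R : realType) (L : R) (g : curve R)
    (A B : set (curve R)) : R :=
  OmegaP L g (xget (fun=> 0) A) (xget (fun=> 0) B).

(* The exterior derivative at g of a 2-form on the vector space of maps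
   R -> C^2, computed by extending U, V, W to constant vector fields. *)
Definition ext_der (R : realType) (om : curve R -> curve R -> curve R -> R)
    (g U V W : curve R) : R :=
  let D X Y Z :=
    derive1 (fun t : R => om (fun x => g x + t%:C *: X x) Y Z) 0 in
  D U V W + D V W U + D W U V.

(* Main.v *)
Require Import Defs.
From mathcomp Require Import all_boot all_order all_algebra.
From mathcomp Require Import all_classical all_reals all_analysis.
From mathcomp Require Import complex.
From mathcomp Require Import ring lra.
Import Order.TTheory GRing.Theory Num.Theory.
Import numFieldNormedType.Exports.
Local Open Scope classical_set_scope.
Local Open Scope ring_scope.
Set Implicit Arguments.
Unset Strict Implicit.
Unset Printing Implicit Defensive.

(** Let r_V = <V, i g> (real inner product) be the value on a vector field V
along g of the contact form of S^3.  For V = p g_x + q (i g_x) + r (i g)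
tangent at a Legendrian g one has r_V = r, and since g, i g, g_x, i g_x are
orthogonal with |g| = 1, the determinant (g, g_x, V, W) is
(q_V r_W - r_V q_W) |g_x|^2.  The tangency condition r_x = 2 q |g_x|^2
eliminates q, and an integration by parts over a period gives
    Omega (V, W) = int_0^L r_V (r_W)_x dx            ([OmegaP_pairing]).

Everything that happens at a single curve is read off this formula.  A
vertical field changes r only by a constant, so the integral does not depend
on the representatives ([OmegaQ_rep]); bilinearity and skew-symmetry are
clear.  If W is in the kernel, testing it against a V with r_V = (r_W)_x gives
int ((r_W)_x)^2 = 0, so r_W is constant, q_W = 0 and W is vertical
([OmegaQ_nondegenerate]).  A rotation preserves r, and a reparametrization phi
replaces r by its composite with phi, which does not change the integral, by
substitution; that the time t map of the flow of a periodic field is such a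
phi follows from uniqueness for the ODE ([flow_diffeo],
[gauge_invariant]).

For closedness, let G (s, x) depend on parameters s, and let subscripts denote
derivatives.  Differentiating det (G, G_x, G_v, G_w) along u and summing
cyclically over u, v, w, the terms with second derivatives among u, v, w
cancel because partial derivatives commute, and what is left is
    d/dx det (G, G_u, G_v, G_w) - 4 det (G_x, G_u, G_v, G_w)
([pullvol_cyclic]).  The first term integrates to zero over a period.  The
second one vanishes as soon as the four vectors are orthogonal to G, that is,
tangent to S^3 ([detR_orthogonal]).  For families of Legendrian curves this
gives d Omega = 0 on pullbacks ([pullback_closed]); for the affine family
g + s_1 U + s_2 V + s_3 W, which consists of Legendrian curves only to first
order, it gives the vanishing of the exterior derivative at g in the directions
U, V, W ([ext_der_OmegaP]).

The analysis behind this is stability of the class of smooth functions under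
the usual operations ([smooth_polyexpr]), symmetry of second derivatives
([derive_sym]), and differentiation under the integral sign
([is_derive_intL]). *)

(** * Smooth functions *)

Section Smooth.
Context {R : realType} {V : normedModType R}.
Implicit Types (f g h : V -> R) (v x : V).

Lemma smooth_continuous f : smooth f -> continuous f.
Proof. by case=> S Sf /(_ f Sf)[]. Qed.

Lemma smooth_derivable f x v : smooth f -> derivable f x v.
Proof. by case=> S Sf /(_ f Sf)[_ /(_ v)[]]. Qed.

Lemma smooth_derive f v : smooth f -> smooth (fun x => 'D_v f x).
Proof. by case=> S Sf cS; exists S => //; have [_ /(_ v)[]] := cS f Sf. Qed.

Lemma smooth_is_derive f x v : smooth f -> is_derive x v f ('D_v f x).
Proof. by move=> sf; apply: derivableP; exact: smooth_derivable. Qed.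

Lemma eq_smooth f g : f =1 g -> smooth f -> smooth g.
Proof. by move=> /funext ->. Qed.

Lemma eq_is_derive f g x v (df : R) : f =1 g ->
  is_derive x v f df -> is_derive x v g df.
Proof. by move=> /funext ->. Qed.

Lemma eq_derive f g x v : f =1 g -> 'D_v f x = 'D_v g x.
Proof. by move=> /funext ->. Qed.

(** Directional derivatives are derivatives at 0 along lines, which reduces
the chain rule and the mean value theorem to functions of one variable. *)
Lemma is_derive_lineP f x v (df : R) :
  is_derive x v f df <-> is_derive (0 : R) 1 (fun h : R => f (h *: v + x)) df.
Proof.
have E : (fun h : R => h^-1 *: (f (h *: v + x) - f x)) =
   (fun h : R => h^-1 *: (f ((h *: (1 : R) + 0 : R) *: v + x) - f ((0 : R) *: v + x))).
  by apply/funext => h; rewrite addr0 scale0r add0r [_%:A]mulr1.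
by split=> -[df1 df2]; apply: DeriveDef; rewrite /derivable/derive/= in df1 df2 *;
   [rewrite -E|rewrite -E|rewrite E|rewrite E].
Qed.

End Smooth.

Section SmoothCalculus.
Context {R : realType} {V : normedModType R}.
Implicit Types (f g h : V -> R) (v x : V) (A : set (V -> R)).

Inductive polyexpr A : (V -> R) -> Prop :=
| PolyGen f : A f -> polyexpr A f
| PolyCst (c : R) : polyexpr A (fun=> c)
| PolyAdd f g : polyexpr A f -> polyexpr A g -> polyexpr A (fun x => f x + g x)
| PolyMul f g : polyexpr A f -> polyexpr A g -> polyexpr A (fun x => f x * g x).

(** A family of functions whose derivatives are polynomial expressions in
the family consists of smooth functions: the polynomial expressions form a class
closed under derivation.  Products, inverses and composites are the cases where
the family is, respectively, that of smooth functions, the same with 1 / f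
added, and the same with all the w (f x), w smooth, added. *)
Lemma smooth_polyexpr A f :
  (forall g, A g -> continuous g /\ forall v, exists2 dg,
     forall x, is_derive x v g (dg x) & polyexpr A dg) ->
  polyexpr A f -> smooth f.
Proof.
move=> hA Af; exists (polyexpr A) => // {f Af} f.
suff H : polyexpr A f -> continuous f /\ forall v, exists2 df,
     forall x, is_derive x v f (df x) & polyexpr A df.
  move=> /H[cf df]; split=> // v; have [g fg Ag] := df v.
  split=> [x|]; first by have [] := fg x.
  suff -> : (fun x => 'D_v (f : V -> R^o) x) = g by [].
  by apply/funext => x; have [] := fg x.
elim=> {f} [f /hA //|c|f g Af [cf df] Ag [cg dg]|f g Af [cf df] Ag [cg dg]].
- split=> [|v]; first exact: cst_continuous.
  exists (fun=> 0); last exact: PolyCst.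
  by move=> x; exact: is_derive_cst.
- split=> [x|v]; first by apply: continuousD; [exact: cf|exact: cg].
  have [f' ff' Af'] := df v; have [g' gg' Ag'] := dg v.
  exists (fun x => f' x + g' x); last exact: PolyAdd.
  by move=> x; exact: is_deriveD.
- split=> [x|v]; first by apply: continuousM; [exact: cf|exact: cg].
  have [f' ff' Af'] := df v; have [g' gg' Ag'] := dg v.
  exists (fun x => f x * g' x + g x * f' x).
    by move=> x; exact: is_deriveM.
  by apply: PolyAdd; apply: PolyMul.
Qed.

Let smooth_self g : smooth g -> continuous g /\ forall v, exists2 dg,
  forall x, is_derive x v g (dg x) & polyexpr (@smooth R V) dg.
Proof.
move=> sg; split=> [|v]; first exact: smooth_continuous.
exists (fun x => 'D_v g x); last by apply: PolyGen; exact: smooth_derive.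
by move=> x; exact: smooth_is_derive.
Qed.

Lemma smooth_cst (c : R) : smooth (fun _ : V => c).
Proof. apply: smooth_polyexpr smooth_self _; exact: PolyCst. Qed.

Lemma smoothD f g : smooth f -> smooth g -> smooth (fun x => f x + g x).
Proof.
by move=> sf sg; apply: smooth_polyexpr smooth_self _; apply: PolyAdd;
  exact: PolyGen.
Qed.

Lemma smoothM f g : smooth f -> smooth g -> smooth (fun x => f x * g x).
Proof.
by move=> sf sg; apply: smooth_polyexpr smooth_self _; apply: PolyMul;
  exact: PolyGen.
Qed.

Lemma smoothN f : smooth f -> smooth (fun x => - f x).
Proof.
move=> sf; rewrite (_ : (fun _ => _) = fun x => -1 * f x).
  by apply: smoothM => //; exact: smooth_cst.
by apply/funext => x; rewrite mulN1r.
Qed.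

Lemma smoothB f g : smooth f -> smooth g -> smooth (fun x => f x - g x).
Proof. by move=> sf sg; apply: smoothD => //; exact: smoothN. Qed.

Lemma smoothV f : (forall x, f x != 0) -> smooth f ->
  smooth (fun x => (f x)^-1).
Proof.
move=> f0 sf.
pose A : set (V -> R) := fun g => smooth g \/ g = fun x => (f x)^-1.
apply: (@smooth_polyexpr A); last by apply: PolyGen; right.
move=> g [sg|->].
  split=> [|v]; first exact: smooth_continuous.
  exists (fun x => 'D_v g x).
    by move=> x; exact: smooth_is_derive.
  by apply: PolyGen; left; exact: smooth_derive.
split=> [x|v].
  by apply: continuousV => //; exact: smooth_continuous.
exists (fun x => (-1 * 'D_v f x) * ((f x)^-1 * (f x)^-1)) => [x|].
  apply: DeriveDef; first by apply: derivableV => //; exact: smooth_derivable.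
  rewrite deriveV//; last exact: smooth_derivable.
  by rewrite -exprVn expr2 /GRing.scale/=; ring.
apply: PolyMul; last by apply: PolyMul; apply: PolyGen; right.
apply: PolyMul; first exact: PolyCst.
by apply: PolyGen; left; exact: smooth_derive.
Qed.

Lemma is_derive_comp1 (u : R -> R) f v x (du df : R) :
  is_derive (f x) 1 u du -> is_derive x v f df ->
  is_derive x v (fun y => u (f y)) (du * df).
Proof.
move=> hu hf; have /is_derive_lineP hf' := hf; apply/is_derive_lineP.
pose p (h : R) := f (h *: v + x).
have hu' : is_derive (p 0) 1 u du by rewrite /p scale0r add0r.
exact: (is_derive1_comp hu' hf').
Qed.

Lemma smooth_comp (u : R -> R) f :
  smooth (u : R^o -> R) -> smooth f -> smooth (fun x => u (f x)).
Proof.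
move=> su sf.
pose A : set (V -> R) := fun g => smooth g \/
  exists2 w : R -> R, smooth (w : R^o -> R) & g = fun x => w (f x).
apply: (@smooth_polyexpr A); last by apply: PolyGen; right; exists u.
move=> g [sg|[w sw ->]].
  split=> [|v]; first exact: smooth_continuous.
  exists (fun x => 'D_v g x).
    by move=> x; exact: smooth_is_derive.
  by apply: PolyGen; left; exact: smooth_derive.
split=> [x|v].
  apply: (@continuous_comp _ _ _ f w); first exact: smooth_continuous.
  exact: (smooth_continuous sw).
exists (fun x => 'D_1 (w : R^o -> R) (f x) * 'D_v f x) => [x|].
  apply: is_derive_comp1; last exact: smooth_is_derive.
  exact: (smooth_is_derive (f x) 1 sw).
apply: PolyMul; apply: PolyGen; [right|left; exact: smooth_derive].
exists (fun y => 'D_1 (w : R^o -> R) y) => //.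
exact: (@smooth_derive R R^o w 1 sw).
Qed.

End SmoothCalculus.

(** Here l is an affine map with linear part d. *)
Lemma is_derive_affine (R : realType) (U V : normedModType R) (l : U -> V)
    (d : U -> V) (f : V -> R) x v df :
  (forall (h : R) w x, l (h *: w + x) = h *: d w + l x) ->
  is_derive (l x) (d v) f df -> is_derive x v (fun x => f (l x)) df.
Proof.
move=> lE /is_derive_lineP H; apply/is_derive_lineP.
rewrite (_ : (fun _ => _) = fun t : R => f (t *: d v + l x))//.
by apply/funext => t; rewrite lE.
Qed.

Lemma smooth_affine (R : realType) (U V : normedModType R) (l : U -> V)
    (d : U -> V) (f : V -> R) :
  continuous l -> (forall (h : R) w x, l (h *: w + x) = h *: d w + l x) ->
  smooth f -> smooth (fun x => f (l x)).
Proof.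
move=> cl lE sf.
exists (fun g => exists2 h : V -> R, smooth h & g = fun x => h (l x)).
  by exists f.
move=> _ [h sh ->]; split=> [x|v].
  apply: (@continuous_comp _ _ _ l h); first exact: cl.
  exact: (smooth_continuous sh).
have H x : is_derive x v (fun x => h (l x)) ('D_(d v) h (l x)).
  by apply: (is_derive_affine lE); exact: (smooth_is_derive _ _ sh).
split=> [x|]; first by have [] := H x.
exists (fun y => 'D_(d v) h y); first exact: smooth_derive.
by apply/funext => x; have [] := H x.
Qed.

Lemma smooth_id (R : realType) : smooth (fun x : R^o => x : R).
Proof.
exists (fun g => g = (fun x : R^o => x : R) \/ exists c : R, g = fun=> c).
  by left.
move=> _ [->|[c ->]]; split.
- by move=> x; exact: cvg_id.
- move=> v; split=> [x|]; first exact: derivable_id.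
  by right; exists v; apply/funext => x; exact: derive_id.
- by move=> x; exact: cst_continuous.
- move=> v; split=> [x|]; first exact: derivable_cst.
  by right; exists 0; apply/funext => x; exact: derive_cst.
Qed.

(** * Functions of one real variable and symmetry of second derivatives *)

Section RealLine.
Context {R : realType}.
Implicit Types (f df F : R -> R) (L : R).

Lemma is_derive_continuous f df : (forall x : R, is_derive x 1 f (df x)) ->
  continuous f.
Proof.
by move=> H x; apply: differentiable_continuous; apply/derivable1_diffP;
   have [] := H x.
Qed.

Lemma mean_value f df (a b : R) : a < b ->
  (forall x : R, is_derive x 1 f (df x)) ->
  exists c, a < c < b /\ f b - f a = df c * (b - a).
Proof.
move=> ab H.
have [|c cab ->] := @MVT R f df a b ab (fun x _ => H x).
  by apply: continuous_subspaceT; exact: (is_derive_continuous H).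
by exists c; split=> //; move: cab; rewrite in_itv.
Qed.

Lemma is_derive0_eq f : (forall x : R, is_derive x 1 f 0) ->
  forall x y, f x = f y.
Proof.
move=> H x y; have W a b : a < b -> f b = f a.
  by move=> /mean_value /(_ H)[c [_ /eqP]]; rewrite mul0r subr_eq0 => /eqP.
by case: (ltgtP x y) => [/W|/W|->].
Qed.

Definition intL L f : R := \int[lebesgue_measure]_(x in `[0, L]) f x.

Lemma continuous_integrable L f : continuous f ->
  lebesgue_measure.-integrable `[0, L] (EFin \o f).
Proof.
move=> cf; apply: continuous_compact_integrable; first exact: segment_compact.
exact: continuous_subspaceT.
Qed.

Lemma eq_intL L f g : f =1 g -> intL L f = intL L g.
Proof. by move=> /funext ->. Qed.

Lemma intLD L f g : continuous f -> continuous g ->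
  intL L (fun x => f x + g x) = intL L f + intL L g.
Proof. by move=> cf cg; apply: RintegralD => //; exact: continuous_integrable. Qed.

Lemma intLZ L (c : R) f : continuous f ->
  intL L (fun x => c * f x) = c * intL L f.
Proof. by move=> cf; apply: RintegralZl => //; exact: continuous_integrable. Qed.

Lemma intLN L f : continuous f -> intL L (fun x => - f x) = - intL L f.
Proof.
move=> cf; rewrite -mulN1r -intLZ//; apply: eq_intL => x; by rewrite mulN1r.
Qed.

Lemma intLB L f g : continuous f -> continuous g ->
  intL L (fun x => f x - g x) = intL L f - intL L g.
Proof. by move=> cf cg; apply: RintegralB => //; exact: continuous_integrable. Qed.

Lemma intL_bound L f (e : R) : 0 < L -> continuous f ->
  (forall x, 0 <= x <= L -> `|f x| <= e) -> `|intL L f| <= e * L.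
Proof.
move=> L0 cf fe; apply: le_trans (_ : intL L (fun x => `|f x|) <= _).
  by apply: le_normr_Rintegral => //; exact: continuous_integrable.
have -> : e * L = intL L (fun=> e).
  rewrite /intL Rintegral_cst//= lebesgue_measure_itv/= lte_fin L0.
  by rewrite /= oppr0 addr0.
apply: le_Rintegral => //=.
- apply: (@continuous_integrable L (fun x => `|f x|)) => x.
  apply: (@continuous_comp _ _ _ f Num.norm); [exact: cf|exact: norm_continuous].
- by apply: (@continuous_integrable L (fun=> e)) => x; exact: cst_continuous.
Qed.

Lemma intL_derive L f F : 0 < L -> continuous f ->
  (forall x : R, is_derive x 1 F (f x)) -> intL L f = F L - F 0.
Proof.
move=> L0 cf H; have cF := is_derive_continuous H.
rewrite /intL /Rintegral (@continuous_FTC2 _ f F 0 L)//.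
- exact: continuous_subspaceT.
- split=> [x _||]; first by have [] := H x.
  + by apply: cvg_at_right_filter; exact: cF.
  + by apply: cvg_at_left_filter; exact: cF.
- by move=> x _; rewrite derive1E; have [] := H x.
Qed.

End RealLine.

Section Schwarz.
Context {R : realType} {V : normedModType R}.
Implicit Types (f : V -> R) (u v x : V).

Lemma smooth_line f x v : smooth f ->
  forall t : R, is_derive t 1 (fun t : R => f (t *: v + x)) ('D_v f (t *: v + x)).
Proof.
move=> sf t; apply: (@is_derive_affine _ _ _ (fun t : R^o => t *: v + x)
  (fun h : R^o => h *: v)).
  by move=> h w y; rewrite scalerDl scalerA addrA.
by rewrite scale1r; exact: smooth_is_derive.
Qed.

(** Two applications of the mean value theorem, first along u to the
difference of f between two parallel segments, then along v to the derivative
of f along u. *)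
Lemma second_difference f x u v (a : R) : smooth f -> 0 < a ->
  exists c c' : R, [/\ 0 < c < a, 0 < c' < a &
   f (a *: u + (a *: v + x)) - f (a *: u + x) - (f (a *: v + x) - f x) =
   'D_v (fun y => 'D_u f y) (c *: u + (c' *: v + x)) * a * a].
Proof.
move=> sf a0.
pose p (t : R) := f (t *: u + (a *: v + x)) - f (t *: u + x).
have dp (t : R) : is_derive t 1 p ('D_u f (t *: u + (a *: v + x)) -
    'D_u f (t *: u + x)).
  by apply: is_deriveB; exact: smooth_line.
have [c [ca pE]] := mean_value a0 dp.
have [c' [c'a qE]] :=
  mean_value a0 (smooth_line (c *: u + x) v (smooth_derive u sf)).
exists c, c'; split=> //.
move: pE; rewrite /p !scale0r !add0r subr0 => ->.
congr (_ * _); move: qE; rewrite !scale0r !add0r subr0.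
by rewrite !(addrCA (_ *: v)).
Qed.

(** The intermediate points produced by [second_difference] tend to x as the
parallelogram shrinks. *)
Lemma near_parallelogram (P : V -> Prop) x u v : (\forall y \near x, P y) ->
  exists2 d : R, 0 < d &
   forall a c c' : R, a < d -> 0 < c < a -> 0 < c' < a ->
     P (c *: u + (c' *: v + x)).
Proof.
move=> /nbhs_ballP[e /= e0 He].
exists (e / (`|u| + `|v| + 1)); first by rewrite divr_gt0// ltr_wpDl// addr_ge0.
move=> a c c' ad /andP[c0 ca] /andP[c'0 c'a]; apply: He.
rewrite -ball_normE/= addrA opprD addrCA subrr addr0 normrN.
apply: le_lt_trans (ler_normD _ _) _.
rewrite !normrZ !gtr0_norm//.
have a0 := lt_trans c0 ca.
apply: le_lt_trans (_ : a * (`|u| + `|v| + 1) < _).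
  rewrite !mulrDr mulr1 -[leLHS]addr0; apply: lerD; last exact: ltW.
  by apply: lerD; apply: ler_wpM2r => //; exact: ltW.
by rewrite -ltr_pdivlMr// ltr_wpDl// addr_ge0.
Qed.

(** The second difference over a parallelogram is symmetric in u and v;
dividing it by a^2 and letting a tend to 0 gives both mixed derivatives, which
are continuous. *)
Lemma derive_sym f u v x : smooth f ->
  'D_v (fun y => 'D_u f y) x = 'D_u (fun y => 'D_v f y) x.
Proof.
move=> sf.
have near_e w w' (e : R) : 0 < e -> \forall y \near x,
    `|'D_w (fun y => 'D_w' f y) x - 'D_w (fun y => 'D_w' f y) y| < e.
  move=> e0.
  have := smooth_continuous (smooth_derive w (smooth_derive w' sf)).
  by move=> /(_ x)/cvgrPdist_lt; apply.
apply/eqP; rewrite -subr_eq0 -normr_le0; apply/ler_addgt0Pr => e e0.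
have e20 : 0 < e / 2 by rewrite divr_gt0.
have [d d0 Hd] := near_parallelogram u v (near_e v u _ e20).
have [d' d'0 Hd'] := near_parallelogram v u (near_e u v _ e20).
pose a := Num.min d d' / 2.
have m0 : 0 < Num.min d d' by rewrite lt_min d0.
have a0 : 0 < a by rewrite divr_gt0.
have am : a < Num.min d d' by rewrite /a ltr_pdivrMr// ltr_pMr// ltr1n.
have ad : a < d by move: am; rewrite lt_min => /andP[].
have ad' : a < d' by move: am; rewrite lt_min => /andP[].
have [c [c' [ca c'a E1]]] := second_difference x u v sf a0.
have [b [b' [ba b'a E2]]] := second_difference x v u sf a0.
have := Hd a c c' ad ca c'a; have := Hd' a b b' ad' ba b'a.
have -> : 'D_v (fun y => 'D_u f y) (c *: u + (c' *: v + x)) =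
  'D_u (fun y => 'D_v f y) (b *: v + (b' *: u + x)).
  have alg (k A B C D X Y : R) : k != 0 -> A - B - (C - D) = X * k * k ->
      A - C - (B - D) = Y * k * k -> X = Y.
    move=> kN0 E1' E2'; apply/(mulIf kN0)/(mulIf kN0); rewrite -E1' -E2'.
    by ring.
  rewrite (addrCA (a *: u)) in E1.
  by apply: alg E1 E2; rewrite gt_eqF.
set A := 'D_u _ (b *: v + _); set B := 'D_v _ x; set C := 'D_u _ x.
move=> H1 H2; rewrite add0r.
have -> : B - C = (B - A) - (C - A) by ring.
apply: le_trans (ler_normB _ _) _; rewrite [e]splitr.
by apply: ltW; apply: ltrD; [exact: H2|exact: H1].
Qed.

End Schwarz.

(** * Integrals depending on a parameter *)

Lemma continuous_pair (T U W : topologicalType) (f : T -> U) (g : T -> W) :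
  continuous f -> continuous g -> continuous (fun x => (f x, g x)).
Proof.
move=> cf cg x.
apply: (@cvg_pair _ _ _ (nbhs x) (nbhs (f x)) (nbhs (g x))); 
  [exact: cf|exact: cg].
Qed.

Section ParametricIntegral.
Context {R : realType} {V : normedModType R}.
Variables (L : R) (L_gt0 : 0 < L).
Implicit Types (F G : V * R^o -> R) (s v : V).

Lemma smooth_slice F s : smooth F -> smooth (fun x : R^o => F (s, x)).
Proof.
move=> sF; apply: (@smooth_affine _ _ _ (fun x : R^o => (s, x) : V * R^o)
  (fun w => (0, w))) => // [|h w x].
  by apply: continuous_pair => x; [exact: cvg_cst|exact: cvg_id].
by congr pair; rewrite /= ?scaler0 ?add0r.
Qed.

Lemma is_derive_fst F s v (x : R) : smooth F ->
  is_derive s v (fun s => F (s, x : R^o)) ('D_(v, 0 : R^o) F (s, x : R^o)).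
Proof.
move=> sF; apply: (@is_derive_affine _ _ _ (fun s => (s, x) : V * R^o)
  (fun w => (w, 0))); last exact: smooth_is_derive.
by move=> h w y; congr pair; rewrite /= ?scaler0 ?add0r.
Qed.

Lemma is_derive_snd F s (x : R) : smooth F ->
  is_derive x 1 (fun x : R => F (s, x : R^o)) ('D_(0 : V, 1 : R^o) F (s, x : R^o)).
Proof.
move=> sF; apply: (@is_derive_affine _ _ _ (fun x : R^o => (s, x) : V * R^o)
  (fun w => (0, w))); last exact: smooth_is_derive.
by move=> h w y; congr pair; rewrite /= ?scaler0 ?add0r.
Qed.

(** The tube lemma: [0, L] is compact, so continuity of F at the points
(s, x) is uniform in x. *)
Lemma near_uniform F s (e : R) : continuous F -> 0 < e ->
  \forall s' \near s, forall x, 0 <= x <= L -> `|F (s', x) - F (s, x)| < e.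
Proof.
move=> cF e0.
have [] := compact_near_coveringP (`[0, L]%classic : set R^o).
move=> /(_ (@segment_compact _ _ _)) + _.
move=> /(_ V (nbhs s) (fun s' x => `|F (s', x) - F (s, x)| < e) _) H.
have {}H : \forall s' \near s,
    `[0, L]%classic `<=` (fun x : R^o => `|F (s', x) - F (s, x)| < e).
  apply: H => x _ /=.
  have /cvgrPdist_lt /(_ (e / 2)) := cF (s, x).
  rewrite divr_gt0// => /(_ isT) [[A B] /= [As Bx] AB].
  exists (B, A) => //= -[x' s'] [/= Bx' As'].
  have H1 := AB (s', x') (conj As' Bx').
  have H2 := AB (s, x') (conj (nbhs_singleton As) Bx').
  rewrite [e]splitr (_ : _ - _ = (F (s, x) - F (s, x')) - (F (s, x) - F (s', x'))).
    by apply: le_lt_trans (ler_normB _ _) _; apply: ltrD.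
  by ring.
move: H; apply: filterS => s' H x xL; apply: H.
by rewrite /= in_itv.
Qed.

Lemma continuous_intL F : smooth F ->
  continuous (fun s => intL L (fun x => F (s, x)) : R).
Proof.
move=> sF s; apply/cvgrPdist_le => e e0.
have cF := smooth_continuous sF.
have := near_uniform s cF (divr_gt0 e0 L_gt0).
apply: filterS => s' H.
have cs s0 : continuous (fun x : R => F (s0, x : R^o)).
  exact: (smooth_continuous (smooth_slice s0 sF)).
rewrite distrC -intLB; [|exact: cs|exact: cs].
rewrite -[leRHS](divfK (lt0r_neq0 L_gt0)).
apply: intL_bound => // [x|x /H /ltW//].
by apply: continuousB; apply: cs.
Qed.

(** By the mean value theorem the difference quotient of F in the direction v
is a value of the derivative of F at a nearby parameter, and that derivative is
close to its value at s uniformly on [0, L]. *)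
Lemma is_derive_intL F s v : smooth F ->
  is_derive s v (fun s => intL L (fun x => F (s, x)))
    (intL L (fun x => 'D_(v, 0 : R^o) F (s, x : R^o))).
Proof.
move=> sF; set G := fun z => 'D_(v, 0 : R^o) F z.
have sG : smooth G by exact: smooth_derive.
have cs H s0 : smooth H -> continuous (fun x : R => H (s0, x : R^o) : R).
  by move=> sH; exact: (smooth_continuous (smooth_slice s0 sH)).
suff C : h^-1 *: (intL L (fun x => F (h *: v + s, x)) - intL L (fun x => F (s, x)))
     @[h --> (0 : R)^'] --> (intL L (fun x => G (s, x)) : R).
  apply: DeriveDef; first exact: (cvgP _ C).
  by apply: cvg_lim => //; exact: C.
apply/cvgrPdist_le => e e0.
have eL := divr_gt0 e0 L_gt0.
have cl : (t : R) *: v + s @[t --> (0 : R)] --> s.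
  rewrite -[X in _ --> X](add0r s) -(scale0r v).
  by apply: cvgD; [exact: scalel_continuous|exact: cvg_cst].
have /nbhs_ballP[d /= d0 Hd] := cl _ (near_uniform s (smooth_continuous sG) eL).
exists d => //= h /= hd h0.
have {}hd : `|h| < d by rewrite -normrN -[- h]add0r.
have mv x : exists2 c : R, `|c| < d &
    F (h *: v + s, x) - F (s, x) = G (c *: v + s, x) * h.
  have dp (t : R) :
      is_derive t 1 (fun t : R => F (t *: v + s, x)) (G (t *: v + s, x)).
    apply: (@is_derive_affine _ _ _ (fun t : R^o => t *: v + s)
      (fun h : R^o => h *: v) (fun s => F (s, x))).
      by move=> k w y; rewrite scalerDl scalerA addrA.
    by rewrite scale1r; exact: is_derive_fst.
  case: (ltgtP h 0) h0 => // [h0|h0] _.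
    have [c [/andP[hc c0]]] := mean_value h0 dp.
    rewrite scale0r add0r sub0r => E; exists c; last by rewrite -opprB E mulrN opprK.
    by apply: lt_trans hd; rewrite !ltr0_norm// ltrN2.
  have [c [/andP[c0 hc]]] := mean_value h0 dp.
  rewrite scale0r add0r subr0 => E; exists c => //.
  by apply: lt_trans hd; rewrite !gtr0_norm.
have cB : continuous (fun x : R => F (h *: v + s, x : R^o) - F (s, x : R^o)).
  by move=> x; apply: continuousB; apply: cs.
rewrite distrC -intLB; [|exact: cs|exact: cs].
rewrite [_ *: _](_ : _ =
    intL L (fun x => h^-1 * (F (h *: v + s, x) - F (s, x)))); last first.
  by rewrite intLZ.
have cB' : continuous
    (fun x : R => h^-1 * (F (h *: v + s, x : R^o) - F (s, x : R^o))).
  by move=> x; apply: cvgM; [exact: cvg_cst|exact: cB].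
rewrite -intLB; [|exact: cB'|exact: cs].
rewrite -[leRHS](divfK (lt0r_neq0 L_gt0)).
apply: intL_bound => // [x|x xL].
  by apply: cvgB; [exact: cB'|exact: cs].
have [c cd ->] := mv x.
rewrite mulrCA mulVf// mulr1 ltW//; apply: Hd => //.
by rewrite -ball_normE/= sub0r normrN.
Qed.

Lemma smooth_intL F : smooth F -> smooth (fun s => intL L (fun x => F (s, x))).
Proof.
move=> sF.
exists (fun I => exists2 G, smooth G & I = fun s => intL L (fun x => G (s, x))).
  by exists F.
move=> _ [G sG ->]; split=> [|v]; first exact: continuous_intL.
split=> [s|]; first by have [] := is_derive_intL s v sG.
exists (fun z => 'D_(v, 0 : R^o) G z); first exact: smooth_derive.
by apply/funext => s; have [] := is_derive_intL s v sG.
Qed.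

End ParametricIntegral.

(** * Real coordinates on C^2 *)

Lemma det_matrix4 (R : comRingType) (f : nat -> nat -> R) :
  let m i j k l := f k i * f l j - f k j * f l i in
  \det (\matrix_(i < 4, j < 4) f i j) =
  m 0 1 0 1 * m 2 3 2 3 - m 0 1 0 2 * m 2 3 1 3 + m 0 1 0 3 * m 2 3 1 2
  + m 0 1 1 2 * m 2 3 0 3 - m 0 1 1 3 * m 2 3 0 2 + m 0 1 2 3 * m 2 3 0 1.
Proof.
move=> m; rewrite {}/m.
pose D n (g : nat -> nat -> R) := \det (\matrix_(i < n, j < n) g i j).
have D1 g : D 1 g = g 0 0 by rewrite /D det_mx11 mxE.
have DS n g : D n.+1 g = \sum_(k < n.+1) (-1) ^+ k * g 0 k *
    D n (fun i j => g i.+1 (bump k j)).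
  rewrite /D (expand_det_row _ ord0); apply: eq_bigr => k _.
  rewrite mxE /cofactor add0n mulrCA mulrA; congr (_ * \det _).
  by apply/matrixP => i j; rewrite !mxE.
rewrite -/(D 4 f) !(DS, big_ord_recr, big_ord0, D1) /= /bump /=.
ring.
Qed.

Section RealCoordinates.
Context {R : realType}.
Implicit Types (u v w a b c d : C2 R) (k : nat).

(** The coordinates of [realify], set to 0 for k >= 4 so that the identities
below hold for every natural number k. *)
Definition rc k u : R :=
  [:: complex.Re (u 0 0); complex.Im (u 0 0);
      complex.Re (u 1 0); complex.Im (u 1 0)]`_k.

Definition J u : C2 R := 'i%C *: u.

Lemma JE u : J u = 'i%C *: u.
Proof. by []. Qed.

Definition dot u v : R :=
  rc 0 u * rc 0 v + rc 1 u * rc 1 v + rc 2 u * rc 2 v + rc 3 u * rc 3 v.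

Lemma rc_eqP u v : (forall k, rc k u = rc k v) -> u = v.
Proof.
move=> H; apply/matrixP => i j; rewrite (ord1 j) {j}.
have E (z z' : R[i]) : complex.Re z = complex.Re z' ->
    complex.Im z = complex.Im z' -> z = z'.
  by case: z z' => [x y] [x' y'] /= -> ->.
have [->|->] : i = 0 \/ i = 1.
  by case: i => -[|[|//]] Hi; [left|right]; apply/val_inj.
- by apply: E; [exact: (H 0%N)|exact: (H 1%N)].
- by apply: E; [exact: (H 2%N)|exact: (H 3%N)].
Qed.

Lemma rcD k u v : rc k (u + v) = rc k u + rc k v.
Proof.
by move: k => [|[|[|[|k]]]]; rewrite /rc /= ?mxE ?nth_nil ?addr0//;
  case: (u _ _) (v _ _) => [? ?] [? ?].
Qed.

Lemma rcZ k (x : R) u : rc k (x%:C%C *: u) = x * rc k u.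
Proof.
by move: k => [|[|[|[|k]]]]; rewrite /rc /= ?mxE ?nth_nil ?mulr0//;
  case: (u _ _) => [? ?] /=; rewrite mul0r ?subr0 ?addr0.
Qed.

Lemma rcDZ k (x y : R) u v :
  rc k (x%:C%C *: u + y%:C%C *: v) = x * rc k u + y * rc k v.
Proof. by rewrite rcD !rcZ. Qed.

Lemma rcDZ3 k (x y z : R) u v w :
  rc k (x%:C%C *: u + y%:C%C *: v + z%:C%C *: w) =
  x * rc k u + y * rc k v + z * rc k w.
Proof. by rewrite rcD rcDZ rcZ. Qed.

Lemma rcDDZ3 k (x y z : R) a u v w :
  rc k (a + x%:C%C *: u + y%:C%C *: v + z%:C%C *: w) =
  rc k a + (x * rc k u + y * rc k v + z * rc k w).
Proof. by rewrite -!addrA rcD addrA rcDZ3 !addrA. Qed.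

Lemma rcN k u : rc k (- u) = - rc k u.
Proof.
by move: k => [|[|[|[|k]]]]; rewrite /rc /= ?mxE ?nth_nil ?oppr0//;
  case: (u _ _) => [? ?].
Qed.

Lemma rc0 k : rc k (0 : C2 R) = 0.
Proof. by move: k => [|[|[|[|k]]]]; rewrite /rc /= ?mxE ?nth_nil. Qed.

Lemma rcJ u : (rc 0 (J u) = - rc 1 u) * (rc 1 (J u) = rc 0 u) *
  (rc 2 (J u) = - rc 3 u) * (rc 3 (J u) = rc 2 u).
Proof.
by rewrite /rc /J /= !mxE; case: (u 0 0) (u 1 0) => [? ?] [? ?] /=;
  rewrite !mul0r !mul1r !add0r.
Qed.

Opaque J.

Lemma hermE u v : herm u v = (dot u v +i* dot u (J v))%C.
Proof.
rewrite /herm big_ord_recr big_ord1 /= /dot !rcJ /rc /=.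
rewrite (_ : widen_ord _ _ = 0); last exact/val_inj.
rewrite (_ : ord_max = 1); last exact/val_inj.
case: (u 0 0) (u 1 0) (v 0 0) (v 1 0) => [? ?] [? ?] [? ?] [? ?] /=.
by congr (_ +i* _)%C; ring.
Qed.

Definition minor2 i j u v := rc i u * rc j v - rc j u * rc i v.

(** Laplace expansion along the first two columns: a sum of six products of
2 x 2 minors, which keeps the product rule and the multilinear identities
within reach of [ring]. *)
Lemma detRE a b c d : detR a b c d =
  minor2 0 1 a b * minor2 2 3 c d - minor2 0 2 a b * minor2 1 3 c d
  + minor2 0 3 a b * minor2 1 2 c d + minor2 1 2 a b * minor2 0 3 c d
  - minor2 1 3 a b * minor2 0 2 c d + minor2 2 3 a b * minor2 0 1 c d.
Proof.
pose f k j := rc k [:: a; b; c; d]`_j.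
have -> : detR a b c d = \det (\matrix_(k < 4, j < 4) f k j).
  by congr (\det _); apply/matrixP => k j; rewrite !mxE.
by rewrite det_matrix4 /f /minor2 /=; ring.
Qed.

Lemma dotC u v : dot u v = dot v u.
Proof. by rewrite /dot; ring. Qed.

Lemma dotJ u v : dot u (J v) = - dot (J u) v.
Proof. by rewrite /dot !rcJ; ring. Qed.

Lemma dotJJ u v : dot (J u) (J v) = dot u v.
Proof. by rewrite /dot !rcJ; ring. Qed.

Lemma dotD u v w : dot (u + v) w = dot u w + dot v w.
Proof. by rewrite /dot !rcD; ring. Qed.

Lemma dotZ (x : R) u v : dot (x%:C%C *: u) v = x * dot u v.
Proof. by rewrite /dot !rcZ; ring. Qed.

Lemma dot_gt0 u : u != 0 -> 0 < dot u u.
Proof.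
move=> u0; rewrite lt_neqAle eq_sym; apply/andP; split; last first.
  by rewrite /dot -!expr2 !addr_ge0// sqr_ge0.
apply: contra u0 => /eqP; rewrite /dot -!expr2 => H.
apply/eqP/rc_eqP => k; rewrite rc0.
have sq (x : R) : 0 <= x ^+ 2 by exact: sqr_ge0.
have sq0 (x : R) : x ^+ 2 <= 0 -> x = 0.
  by move=> x0; apply/eqP; rewrite -sqrf_eq0 eq_le x0 sq.
move: (sq (rc 0 u)) (sq (rc 1 u)) (sq (rc 2 u)) (sq (rc 3 u)) => h0 h1 h2 h3.
move: k => [|[|[|[|k]]]]; try by (apply: sq0; lra).
by rewrite /rc nth_default.
Qed.

(** Only the products q r' and r q' survive, with factor
- det (g, X, i g, i X), which is the square of the modulus of the complex
determinant of (g, X), hence given by Lagrange's identity. *)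
Lemma detR_contact g X (p q r p' q' r' : R) :
  detR g X (p%:C%C *: X + q%:C%C *: J X + r%:C%C *: J g)
           (p'%:C%C *: X + q'%:C%C *: J X + r'%:C%C *: J g) =
  (q * r' - r * q') *
  (dot g g * dot X X - dot X g ^+ 2 - dot X (J g) ^+ 2).
Proof.
have E Y Z V W : (forall k, rc k V = p * rc k X + q * rc k Y + r * rc k Z) ->
    (forall k, rc k W = p' * rc k X + q' * rc k Y + r' * rc k Z) ->
    detR g X V W = (q * r' - r * q') * detR g X Y Z.
  by move=> hV hW; rewrite !detRE /minor2 !hV !hW; ring.
rewrite (E (J X) (J g)) => [|k|k]; [|by rewrite !rcD !rcZ..].
by congr (_ * _); rewrite detRE /minor2 /dot !rcJ; ring.
Qed.

(** Replacing the columns of a matrix in turn by their images under a linear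
map P and adding up the determinants multiplies the determinant by the trace of
P.  Here P u = <u, g> g. *)
Lemma detR_trace_rank1 g a b c d :
  dot g g * detR a b c d =
  dot a g * detR g b c d + dot b g * detR a g c d
  + dot c g * detR a b g d + dot d g * detR a b c g.
Proof. by rewrite !detRE /minor2 /dot; ring. Qed.

Lemma detR_orthogonal g a b c d : dot g g = 1 ->
  dot a g = 0 -> dot b g = 0 -> dot c g = 0 -> dot d g = 0 -> detR a b c d = 0.
Proof.
move=> g1 ag bg cg dg; rewrite -[LHS]mul1r -g1 detR_trace_rank1 ag bg cg dg.
by rewrite !mul0r !addr0.
Qed.

(** The vector X is a complex multiple l + i m of the unit vector
(- conj g_2, conj g_1), so g, i g, X, i X is an orthogonal basis and the formula
is the expansion of U in it. *)
Lemma orthogonal_decomposition g X U : dot g g = 1 -> dot X g = 0 ->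
  dot X (J g) = 0 -> X != 0 -> dot U g = 0 ->
  U = (dot U X / dot X X)%:C%C *: X + (dot U (J X) / dot X X)%:C%C *: J X
      + (dot U (J g))%:C%C *: J g.
Proof.
move=> g1 Xg XJg X0 Ug.
have XX : dot X X != 0 by rewrite gt_eqF// dot_gt0.
(* The complex determinant of (g, X) is l + i m. *)
pose l := rc 0 g * rc 2 X - rc 1 g * rc 3 X - rc 2 g * rc 0 X + rc 3 g * rc 1 X.
pose m := rc 0 g * rc 3 X + rc 1 g * rc 2 X - rc 2 g * rc 1 X - rc 3 g * rc 0 X.
have e0 : rc 0 X = - l * rc 2 g - m * rc 3 g.
  transitivity (dot g g * rc 0 X - rc 0 g * dot X g + rc 1 g * dot X (J g)).
    by rewrite g1 Xg XJg; ring.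
  by rewrite /l /m /dot !rcJ; ring.
have e1 : rc 1 X = l * rc 3 g - m * rc 2 g.
  transitivity (dot g g * rc 1 X - rc 1 g * dot X g - rc 0 g * dot X (J g)).
    by rewrite g1 Xg XJg; ring.
  by rewrite /l /m /dot !rcJ; ring.
have e2 : rc 2 X = l * rc 0 g + m * rc 1 g.
  transitivity (dot g g * rc 2 X - rc 2 g * dot X g + rc 3 g * dot X (J g)).
    by rewrite g1 Xg XJg; ring.
  by rewrite /l /m /dot !rcJ; ring.
have e3 : rc 3 X = - l * rc 1 g + m * rc 0 g.
  transitivity (dot g g * rc 3 X - rc 3 g * dot X g - rc 2 g * dot X (J g)).
    by rewrite g1 Xg XJg; ring.
  by rewrite /l /m /dot !rcJ; ring.
have NE : dot X X = l ^+ 2 + m ^+ 2.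
  transitivity ((l ^+ 2 + m ^+ 2) * dot g g); last by rewrite g1 mulr1.
  by rewrite /dot e0 e1 e2 e3; ring.
suff key k : dot X X * rc k U = dot U X * rc k X + dot U (J X) * rc k (J X)
    + dot X X * (dot U (J g) * rc k (J g)).
  apply: rc_eqP => k; rewrite !rcD !rcZ; apply: (mulfI XX); rewrite key.
  by rewrite 2!mulrDr !(mulrCA (dot X X)) !mulrA divfK// divfK.
have {}Ug : forall z, z = z + (l ^+ 2 + m ^+ 2) * (dot U g * rc k g).
  by move=> z; rewrite Ug mul0r mulr0 addr0.
rewrite [RHS]Ug NE -{1}[rc k U]mul1r -g1 /dot !rcJ.
move: k {Ug} => [|[|[|[|k]]]].
- by rewrite !rcJ e0 e1 e2 e3; ring.
- by rewrite !rcJ e0 e1 e2 e3; ring.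
- by rewrite !rcJ e0 e1 e2 e3; ring.
- by rewrite !rcJ e0 e1 e2 e3; ring.
- have rc4 u : rc k.+4 u = 0 by rewrite /rc nth_default.
  by rewrite !rc4 !(mulr0, addr0).
Qed.

End RealCoordinates.

Section VectorCalculus.
Context {R : realType} {V : normedModType R}.
Implicit Types (f g : V -> R) (a b c d : V -> C2 R) (v x : V).

Definition is_deriveC2 x v a (da : C2 R) :=
  forall k, is_derive x v (fun y => rc k (a y)) (rc k da).

Lemma eq_smoothC2 a b : a =1 b -> smoothC2 a -> smoothC2 b.
Proof. by move=> /funext ->. Qed.

Lemma smoothC2P a : smoothC2 a <-> forall k, smooth (fun x => rc k (a x)).
Proof.
split=> [sa [|[|[|[|k]]]]|sa k]; rewrite /rc /=.
- by have [] := sa 0.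
- by have [] := sa 0.
- by have [] := sa 1.
- by have [] := sa 1.
- apply: (@eq_smooth _ _ (fun=> 0)) => [x|]; first by rewrite nth_default.
  exact: smooth_cst.
- have [->|->] : k = 0 \/ k = 1.
    by case: k => -[|[|//]] Hk; [left|right]; apply/val_inj.
  + by split; [exact: (sa 0%N)|exact: (sa 1%N)].
  + by split; [exact: (sa 2%N)|exact: (sa 3%N)].
Qed.

Lemma rc_derC2 k v a x : rc k (derC2 v a x) = 'D_v (fun y => rc k (a y)) x.
Proof.
move: k => [|[|[|[|k]]]]; rewrite /rc /= ?mxE//.
by rewrite nth_nil derive_cst.
Qed.

Lemma smooth_is_deriveC2 a x v : smoothC2 a -> is_deriveC2 x v a (derC2 v a x).
Proof.
by move=> /smoothC2P sa k; rewrite rc_derC2; exact: smooth_is_derive.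
Qed.

Lemma is_derive_derC2 x v a da : is_deriveC2 x v a da -> derC2 v a x = da.
Proof. by move=> H; apply: rc_eqP => k; rewrite rc_derC2; have [] := H k. Qed.

Lemma smooth_derC2 a v : smoothC2 a -> smoothC2 (derC2 v a).
Proof.
move=> /smoothC2P sa; apply/smoothC2P => k.
apply: (@eq_smooth _ _ (fun x => 'D_v (fun y => rc k (a y)) x)) => [x|].
  by rewrite rc_derC2.
exact: smooth_derive.
Qed.

Lemma is_deriveDf f g x v (df dg : R) : is_derive x v f df ->
  is_derive x v g dg -> is_derive x v (fun y => f y + g y) (df + dg).
Proof. by move=> ? ?; exact: is_deriveD. Qed.

Lemma is_deriveBf f g x v (df dg : R) : is_derive x v f df ->
  is_derive x v g dg -> is_derive x v (fun y => f y - g y) (df - dg).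
Proof. by move=> ? ?; exact: is_deriveB. Qed.

Lemma is_deriveMf f g x v (df dg : R) : is_derive x v f df ->
  is_derive x v g dg -> is_derive x v (fun y => f y * g y) (f x * dg + g x * df).
Proof. by move=> ? ?; exact: is_deriveM. Qed.

Lemma is_derive_dot a b da db x v : is_deriveC2 x v a da ->
  is_deriveC2 x v b db ->
  is_derive x v (fun y => dot (a y) (b y)) (dot da (b x) + dot (a x) db).
Proof.
move=> ha hb; apply: is_derive_eq.
  by apply: is_deriveDf; [apply: is_deriveDf; [apply: is_deriveDf|]|];
    (apply: is_deriveMf; [exact: ha|exact: hb]).
by rewrite /dot; ring.
Qed.

Lemma is_derive_minor2 i j a b da db x v : is_deriveC2 x v a da ->
  is_deriveC2 x v b db ->
  is_derive x v (fun y => minor2 i j (a y) (b y))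
    (minor2 i j da (b x) + minor2 i j (a x) db).
Proof.
move=> ha hb; apply: is_derive_eq.
  by apply: is_deriveBf; (apply: is_deriveMf; [exact: ha|exact: hb]).
by rewrite /minor2; ring.
Qed.

Lemma is_derive_detR a b c d da db dc dd x v : is_deriveC2 x v a da ->
  is_deriveC2 x v b db -> is_deriveC2 x v c dc -> is_deriveC2 x v d dd ->
  is_derive x v (fun y => detR (a y) (b y) (c y) (d y))
    (detR da (b x) (c x) (d x) + detR (a x) db (c x) (d x)
     + detR (a x) (b x) dc (d x) + detR (a x) (b x) (c x) dd).
Proof.
move=> ha hb hc hd.
apply: (eq_is_derive (fun y => esym (detRE (a y) (b y) (c y) (d y)))).
have M i j k l :=
  is_deriveMf (is_derive_minor2 i j ha hb) (is_derive_minor2 k l hc hd).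
apply: is_derive_eq.
by rewrite !detRE; ring.
Qed.

Lemma smooth_dot a b : smoothC2 a -> smoothC2 b ->
  smooth (fun x => dot (a x) (b x)).
Proof.
move=> /smoothC2P sa /smoothC2P sb.
by do ![apply: smoothD]; apply: smoothM.
Qed.

Lemma smooth_detR a b c d : smoothC2 a -> smoothC2 b -> smoothC2 c ->
  smoothC2 d -> smooth (fun x => detR (a x) (b x) (c x) (d x)).
Proof.
move=> /smoothC2P sa /smoothC2P sb /smoothC2P sc /smoothC2P sd.
apply: (eq_smooth (fun y => esym (detRE (a y) (b y) (c y) (d y)))).
have sm i j e (f : V -> C2 R) : (forall k, smooth (fun x => rc k (e x))) ->
    (forall k, smooth (fun x => rc k (f x))) ->
    smooth (fun x : V => minor2 i j (e x) (f x)).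
  by move=> se sf; apply: smoothB; apply: smoothM.
by apply: smoothD; [apply: smoothB; [apply: smoothD;
    [apply: smoothD; [apply: smoothB|]|]|]|]; (apply: smoothM; apply: sm).
Qed.

Lemma smoothC2J a : smoothC2 a -> smoothC2 (fun x => J (a x)).
Proof.
move=> /smoothC2P sa; apply/smoothC2P => -[|[|[|[|k]]]].
- apply: (@eq_smooth _ _ (fun x => - rc 1 (a x))) => [x|]; first by rewrite rcJ.
  exact: smoothN.
- apply: (@eq_smooth _ _ (fun x => rc 0 (a x))) => [x|]; first by rewrite rcJ.
  exact: sa.
- apply: (@eq_smooth _ _ (fun x => - rc 3 (a x))) => [x|]; first by rewrite rcJ.
  exact: smoothN.
- apply: (@eq_smooth _ _ (fun x => rc 2 (a x))) => [x|]; first by rewrite rcJ.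
  exact: sa.
- apply: (@eq_smooth _ _ (fun=> 0)) => [x|]; first by rewrite /rc nth_default.
  exact: smooth_cst.
Qed.

Lemma is_deriveC2J a x v da : is_deriveC2 x v a da ->
  is_deriveC2 x v (fun y => J (a y)) (J da).
Proof.
move=> ha [|[|[|[|k]]]]; rewrite ?rcJ.
- apply: eq_is_derive (is_deriveN (ha _)) => y; by rewrite rcJ.
- apply: eq_is_derive (ha _) => y; by rewrite rcJ.
- apply: eq_is_derive (is_deriveN (ha _)) => y; by rewrite rcJ.
- apply: eq_is_derive (ha _) => y; by rewrite rcJ.
- rewrite [rc _ (J da)](_ : _ = 0); last by rewrite /rc nth_default.
  apply: eq_is_derive (is_derive_cst (0 : R) x v) => y; by rewrite /rc nth_default.
Qed.

Lemma smoothC2D a b : smoothC2 a -> smoothC2 b -> smoothC2 (fun x => a x + b x).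
Proof.
move=> /smoothC2P sa /smoothC2P sb; apply/smoothC2P => k.
apply: (@eq_smooth _ _ (fun x => rc k (a x) + rc k (b x))) => [x|].
  by rewrite rcD.
exact: smoothD.
Qed.

Lemma smoothC2Z f a : smooth f -> smoothC2 a -> smoothC2 (fun x => (f x)%:C%C *: a x).
Proof.
move=> sf /smoothC2P sa; apply/smoothC2P => k.
apply: (@eq_smooth _ _ (fun x => f x * rc k (a x))) => [x|].
  by rewrite rcZ.
exact: smoothM.
Qed.

Lemma derC2_sym a u v x : smoothC2 a ->
  derC2 v (derC2 u a) x = derC2 u (derC2 v a) x.
Proof.
move=> /smoothC2P sa; apply: rc_eqP => k.
have E w w' : rc k (derC2 w (derC2 w' a) x) =
    'D_w (fun y => 'D_w' (fun z => rc k (a z)) y) x.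
  rewrite rc_derC2; apply: eq_derive => y; exact: rc_derC2.
exact: etrans (E v u) (etrans (derive_sym u v x (sa k)) (esym (E u v))).
Qed.

End VectorCalculus.

(** * The form in terms of the contact component *)

Section Curves.
Context {R : realType}.
Variables (L : R) (L_gt0 : 0 < L).
Implicit Types (g U V W : curve R) (f p q r s : R -> R).

Lemma smooth_is_derive1 f x : smooth (f : R^o -> R) ->
  is_derive (x : R) 1 f ((derive1 f) x).
Proof. by move=> sf; rewrite derive1E; exact: (@smooth_is_derive R R^o). Qed.

Lemma smooth_derive1 f : smooth (f : R^o -> R) -> smooth (derive1 f : R^o -> R).
Proof.
move=> sf; apply: eq_smooth (@smooth_derive R R^o f 1 sf) => x.
by rewrite derive1E.
Qed.

Lemma smooth_continuous1 f : smooth (f : R^o -> R) -> continuous f.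
Proof. exact: (@smooth_continuous R R^o). Qed.

Lemma is_derive_derive1 f x df : is_derive (x : R) 1 f df -> (derive1 f) x = df.
Proof. by move=> H; rewrite derive1E; have [] := H. Qed.

Lemma is_derive_translate f x c df : is_derive (x + c : R) 1 f df ->
  is_derive (x : R) 1 (fun y => f (y + c)) df.
Proof.
apply: (@is_derive_affine R R^o R^o (fun y => y + c) id f).
by move=> h w y; rewrite addrA.
Qed.

Lemma periodic_derive1 f : smooth_periodic L f -> smooth_periodic L (derive1 f).
Proof.
move=> [sf pf]; split; first exact: smooth_derive1.
move=> x; apply/esym/is_derive_derive1.
have H := is_derive_translate (smooth_is_derive1 (x + L) sf).
by apply: (@eq_is_derive R R^o) H => y; rewrite pf.
Qed.

Lemma smooth_periodic_cst c : smooth_periodic L (fun=> c).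
Proof. by split => //; exact: smooth_cst. Qed.

Lemma smooth_periodicM f r : smooth_periodic L f -> smooth_periodic L r ->
  smooth_periodic L (fun x => f x * r x).
Proof.
move=> [sf pf] [sr pr]; split; first exact: smoothM.
by move=> x; rewrite pf pr.
Qed.

Lemma smooth_periodicD f r : smooth_periodic L f -> smooth_periodic L r ->
  smooth_periodic L (fun x => f x + r x).
Proof.
move=> [sf pf] [sr pr]; split; first exact: smoothD.
by move=> x; rewrite pf pr.
Qed.

Lemma smooth_periodicV f : (forall x, f x != 0) -> smooth_periodic L f ->
  smooth_periodic L (fun x => (f x)^-1).
Proof.
move=> f0 [sf pf]; split; first exact: smoothV.
by move=> x; rewrite pf.
Qed.

Lemma intL_periodic_derive1 f : smooth_periodic L f -> intL L (derive1 f) = 0.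
Proof.
move=> [sf pf]; have H x : is_derive (x : R) 1 f (derive1 f x).
  exact: smooth_is_derive1.
rewrite (intL_derive L_gt0 _ H); last first.
  by apply: smooth_continuous1; exact: smooth_derive1.
by rewrite -[L in f L]add0r pf subrr.
Qed.

Definition pairing r s : R := intL L (fun x => r x * (derive1 s) x).

(** Integration by parts over a period. *)
Lemma pairing_skew r s : smooth_periodic L r -> smooth_periodic L s ->
  pairing r s = - pairing s r.
Proof.
move=> pr ps; have [[sr _] [ss _]] := (pr, ps).
have [[sr' _] [ss' _]] := (periodic_derive1 pr, periodic_derive1 ps).
apply/eqP; rewrite -addr_eq0; apply/eqP.
rewrite -(intL_periodic_derive1 (smooth_periodicM pr ps)) -intLD.
- apply: eq_intL => x; apply/esym/is_derive_derive1.
  by apply: is_deriveMf; exact: smooth_is_derive1.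
- by apply: smooth_continuous1; exact: smoothM.
- by apply: smooth_continuous1; exact: smoothM.
Qed.

Lemma pairing_linear (a : R) r r' s : smooth_periodic L r ->
  smooth_periodic L r' -> smooth_periodic L s ->
  pairing (fun x => a * r x + r' x) s = a * pairing r s + pairing r' s.
Proof.
move=> [sr _] [sr' _] [/smooth_derive1 ss _].
have c := @smooth_continuous1.
rewrite /pairing -intLZ; last by apply: c; exact: smoothM.
rewrite -intLD; first by apply: eq_intL => x; rewrite mulrDl mulrA.
- by apply: c; apply: smoothM; [exact: smooth_cst|exact: smoothM].
- by apply: c; exact: smoothM.
Qed.

Lemma pairing_cst a s : smooth_periodic L s -> pairing (fun=> a) s = 0.
Proof.
move=> ps; have [ss _] := periodic_derive1 ps.
by rewrite /pairing intLZ ?intL_periodic_derive1 ?mulr0//; exact: smooth_continuous1.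
Qed.

Lemma pairing_shiftl a r s : smooth_periodic L r -> smooth_periodic L s ->
  pairing (fun x => r x + a) s = pairing r s.
Proof.
move=> pr ps; rewrite -[RHS]addr0 -(pairing_cst a ps) -[pairing r s]mul1r.
rewrite -pairing_linear//; last exact: smooth_periodic_cst.
by congr pairing; apply/funext => x; rewrite mul1r.
Qed.

Lemma pairing_shiftr a r s : smooth_periodic L r -> smooth_periodic L s ->
  pairing r (fun x => s x + a) = pairing r s.
Proof.
move=> pr ps; rewrite [RHS]pairing_skew// -[pairing s r](pairing_shiftl a)//.
by apply: pairing_skew => //; apply: smooth_periodicD => //; exact: smooth_periodic_cst.
Qed.

(** The contact form of S^3 evaluated on V. *)
Definition contact g V : R -> R := fun x => dot (V x) (J (g x)).

Lemma inPE g : inP L g <-> [/\ smoothC2 (V := R^o) g,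
    forall x, g (x + L) = g x,
    forall x, dot (g x) (g x) = 1,
    forall x, dx g x != 0 &
    forall x, dot (dx g x) (g x) = 0 /\ dot (dx g x) (J (g x)) = 0].
Proof.
split=> [[sg pg g1 g0 gg]|[sg pg g1 g0 gg]]; split=> //.
- by move=> x; have := g1 x; rewrite hermE => -[].
- by move=> x; have := gg x; rewrite hermE => -[-> ->].
- move=> x; rewrite hermE g1 (_ : dot _ _ = 0)//.
  by apply/eqP; rewrite -[_ == _](@mulrn_eq0 _ _ 2) mulr2n {1}dotJ dotC addNr.
- by move=> x; rewrite hermE; have [-> ->] := gg x.
Qed.

Lemma dotuJ (u : C2 R) : dot u (J u) = 0.
Proof. by rewrite /dot !rcJ; ring. Qed.

(** Tangency at g, with the coefficient functions exposed and the condition on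
r written over the reals. *)
Definition tangent_fields g V p q r :=
  [/\ smooth_periodic L p, smooth_periodic L q, smooth_periodic L r,
      forall x, (derive1 r) x = 2 * q x * dot (dx g x) (dx g x) &
      forall x, V x = (p x)%:C%C *: dx g x + (q x)%:C%C *: J (dx g x)
                      + (r x)%:C%C *: J (g x)].

Lemma tangentPE g V : tangentP L g V <-> exists p q r, tangent_fields g V p q r.
Proof.
have E (x y z : R) : (x%:C%C = 2 * y%:C%C * (z +i* 0)%C) <-> x = 2 * y * z.
  split=> [/(congr1 (@complex.Re _)) /= ->|->]; first by ring.
  by rewrite /real_complex_def /=; congr (_ +i* _)%C; ring.
by split=> -[p [q [r [sp sq sr H VE]]]]; exists p, q, r; split=> // x;
  try (by have := H x; rewrite hermE dotuJ => /E); rewrite VE !JE.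
Qed.

Lemma contactE g V p q r : inP L g -> tangent_fields g V p q r ->
  contact g V = r.
Proof.
move=> /inPE[_ _ g1 _ gg] [_ _ _ _ VE]; apply/funext => x.
have [Xg XJg] := gg x.
by rewrite /contact VE !dotD !dotZ XJg dotJJ Xg dotJJ g1; ring.
Qed.

Lemma contact_smooth_periodic g V : inP L g -> tangentP L g V ->
  smooth_periodic L (contact g V).
Proof. by move=> Pg /tangentPE[p [q [r H]]]; rewrite (contactE Pg H); case: H. Qed.

(** With q = r_x / (2 |g_x|^2) the integrand is half of r r'_x - r_x r', and
it differs from r r'_x by half the derivative of r r'. *)
Lemma OmegaP_pairing g V W : inP L g -> tangentP L g V -> tangentP L g W ->
  OmegaP L g V W = pairing (contact g V) (contact g W).
Proof.
move=> Pg /tangentPE[p [q [r HV]]] /tangentPE[p' [q' [r' HW]]].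
rewrite (contactE Pg HV) (contactE Pg HW).
case: HV HW => _ [sq _] pr rE VE [_ [sq' _] pr' rE' WE].
have [sg pg g1 g0 gg] := (inPE g).1 Pg.
pose F x := (q x * r' x - r x * q' x) * dot (dx g x) (dx g x).
have FE x : detR (g x) (dx g x) (V x) (W x) = F x.
  have [Xg XJg] := gg x.
  by rewrite VE WE detR_contact g1 Xg XJg /F expr0n/= !subr0 mul1r.
have [[sr _] [sr' _]] := (pr, pr').
have sX := @smooth_derC2 _ R^o _ 1 sg.
have cF : continuous F.
  apply: smooth_continuous1; apply: smoothM; last exact: smooth_dot.
  by apply: smoothB; exact: smoothM.
have crr : continuous (derive1 (fun x => r x * r' x)).
  by apply: smooth_continuous1; apply: smooth_derive1; exact: smoothM.
have -> : OmegaP L g V W = - intL L F by congr (- _); exact: eq_intL.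
rewrite -[LHS]addr0 -(mulr0 2^-1).
rewrite -(intL_periodic_derive1 (smooth_periodicM pr pr')) -intLZ// -intLN// -intLD.
- apply: eq_intL => x.
  rewrite (is_derive_derive1
    (is_deriveMf (smooth_is_derive1 x sr) (smooth_is_derive1 x sr'))).
  by rewrite rE rE' /F; field.
- by move=> x; apply: cvgN; exact: cF.
- by move=> x; apply: cvgM; [exact: cvg_cst|exact: crr].
Qed.

(** Of the two generators of the vertical fields only i g has a contact
component, and its coefficient is a constant. *)
Lemma vertical_contact g V W : inP L g -> vertical L g (fun x => V x - W x) ->
  exists a, forall x, contact g V x = contact g W x + a.
Proof.
move=> /inPE[_ _ g1 _ gg] [a [f [_ VE]]]; exists a => x.
have [Xg XJg] := gg x.
rewrite /contact -[V x](subrK (W x)) VE -JE dotD addrC dotD !dotZ XJg dotJJ g1.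
by ring.
Qed.

Lemma vertical0 g V : vertical L g (fun x => V x - V x).
Proof.
exists 0, (fun=> 0); split; first exact: smooth_periodic_cst.
by move=> x; rewrite subrr !scale0r addr0.
Qed.

Lemma tclass_self g V : tangentP L g V -> tclass L g V V.
Proof. by move=> tV; split=> //; exact: vertical0. Qed.

Lemma tangentQ_rep g A V V' : inP L g -> tangentQ L g A -> A V -> A V' ->
  [/\ tangentP L g V, tangentP L g V' &
    exists a, forall x, contact g V x = contact g V' x + a].
Proof.
move=> Pg [V0 _ ->] [tV vV] [tV' vV']; split=> //.
have [a aE] := vertical_contact Pg vV; have [b bE] := vertical_contact Pg vV'.
by exists (a - b) => x; rewrite aE bE; ring.
Qed.

Lemma OmegaP_rep g A B V W V' W' : inP L g -> tangentQ L g A ->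
  tangentQ L g B -> A V -> A V' -> B W -> B W' ->
  OmegaP L g V W = OmegaP L g V' W'.
Proof.
move=> Pg tA tB AV AV' BW BW'.
have [tV tV' [a /funext aE]] := tangentQ_rep Pg tA AV AV'.
have [tW tW' [b /funext bE]] := tangentQ_rep Pg tB BW BW'.
have pc := @contact_smooth_periodic.
rewrite (OmegaP_pairing Pg tV tW) (OmegaP_pairing Pg tV' tW') aE bE.
have pcW' := pc _ _ Pg tW'.
rewrite pairing_shiftl; first by apply: pairing_shiftr => //; exact: pc.
- exact: pc.
- by apply: smooth_periodicD => //; exact: smooth_periodic_cst.
Qed.

Lemma OmegaQ_rep g A B V W : inP L g -> tangentQ L g A -> tangentQ L g B ->
  A V -> B W -> OmegaQ L g A B = OmegaP L g V W.
Proof.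
move=> Pg tA tB AV BW; apply: (OmegaP_rep Pg tA tB) => //; apply: xgetPex;
  [by exists V|by exists W].
Qed.

Lemma tclass_tangentQ g V : tangentP L g V -> tangentQ L g (tclass L g V).
Proof. by move=> tV; exists V. Qed.

Lemma OmegaQ_tclass g V W : inP L g -> tangentP L g V -> tangentP L g W ->
  OmegaQ L g (tclass L g V) (tclass L g W) = OmegaP L g V W.
Proof.
move=> Pg tV tW; apply: OmegaQ_rep => //.
all: by [exact: tclass_tangentQ|exact: tclass_self].
Qed.

Lemma tangentP_linear g (a : R) V V' : tangentP L g V -> tangentP L g V' ->
  tangentP L g (fun x => a%:C%C *: V x + V' x).
Proof.
move=> /tangentPE[p [q [r [pp pq pr rE VE]]]].
move=> /tangentPE[p' [q' [r' [pp' pq' pr' rE' VE']]]]; apply/tangentPE.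
have lin f f' : smooth_periodic L f -> smooth_periodic L f' ->
    smooth_periodic L (fun x => a * f x + f' x).
  move=> pf pf'; apply: smooth_periodicD => //.
  by apply: smooth_periodicM => //; exact: smooth_periodic_cst.
exists (fun x => a * p x + p' x), (fun x => a * q x + q' x),
  (fun x => a * r x + r' x); split; try exact: lin.
- move=> x; have [[sr _] [sr' _]] := (pr, pr').
  have H := is_deriveDf (is_deriveMf (is_derive_cst a x 1) (smooth_is_derive1 x sr))
    (smooth_is_derive1 x sr').
  by rewrite (is_derive_derive1 H) rE rE' /=; ring.
- move=> x; rewrite VE VE'; move: (dx g x) (J (dx g x)) (J (g x)) => X Y Z.
  apply: rc_eqP => k.
  by rewrite rcD rcZ !rcDZ3; ring.
Qed.

Lemma contact_linear g (a : R) V V' :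
  contact g (fun x => a%:C%C *: V x + V' x) =
  fun x => a * contact g V x + contact g V' x.
Proof. by apply/funext => x; rewrite /contact dotD dotZ. Qed.

Lemma OmegaQ_linear g (a : R) V V' W :
  inP L g -> tangentP L g V -> tangentP L g V' -> tangentP L g W ->
  OmegaQ L g (tclass L g (fun x => a%:C%C *: V x + V' x)) (tclass L g W) =
  a * OmegaQ L g (tclass L g V) (tclass L g W)
  + OmegaQ L g (tclass L g V') (tclass L g W).
Proof.
move=> Pg tV tV' tW; have tl := tangentP_linear a tV tV'.
rewrite (OmegaQ_tclass Pg tl tW) (OmegaQ_tclass Pg tV tW) (OmegaQ_tclass Pg tV' tW).
rewrite (OmegaP_pairing Pg tl tW) (OmegaP_pairing Pg tV tW) (OmegaP_pairing Pg tV' tW).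
rewrite contact_linear.
by apply: pairing_linear; exact: contact_smooth_periodic.
Qed.

Lemma OmegaQ_skew g A B : inP L g -> tangentQ L g A -> tangentQ L g B ->
  OmegaQ L g A B = - OmegaQ L g B A.
Proof.
move=> Pg [V tV ->] [W tW ->].
rewrite (OmegaQ_tclass Pg tV tW) (OmegaQ_tclass Pg tW tV).
rewrite (OmegaP_pairing Pg tV tW) (OmegaP_pairing Pg tW tV).
by apply: pairing_skew; exact: contact_smooth_periodic.
Qed.

End Curves.

(** * Antiderivatives and nondegeneracy *)

Section Antiderivative.
Context {R : realType}.
Implicit Types (f H : R -> R).

Lemma smooth_fst (U V : normedModType R) (f : U -> R) :
  smooth f -> smooth (fun z : U * V => f z.1).
Proof.
move=> sf; apply: (@smooth_affine R _ _ fst fst) => //.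
by move=> z; exact: cvg_fst.
Qed.

Lemma smooth_snd (U V : normedModType R) (f : V -> R) :
  smooth f -> smooth (fun z : U * V => f z.2).
Proof.
move=> sf; apply: (@smooth_affine R _ _ snd snd) => //.
by move=> z; exact: cvg_snd.
Qed.

(** The antiderivative is int_0^1 x f (t x) dt: differentiating it under the
integral sign gives the integral of the t-derivative of t f (t x). *)
Lemma antiderivative f : smooth (f : R^o -> R) ->
  exists H, forall x : R, is_derive x 1 H (f x).
Proof.
move=> sf.
pose F (z : R^o * R^o) : R := z.1 * f (z.1 * z.2).
have sF : smooth F.
  apply: smoothM; first exact: smooth_fst (@smooth_id R).
  apply: (smooth_comp sf); apply: smoothM.
    exact: smooth_fst (@smooth_id R).
  exact: smooth_snd (@smooth_id R).
exists (fun x => intL 1 (fun t => F (x, t))) => x.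
apply: is_derive_eq (is_derive_intL ltr01 (x : R^o) (1 : R^o) sF) _.
have did (y : R) : is_derive (y : R) 1 (fun s : R => s) 1.
  exact: is_derive_id.
have lin (c y : R) : is_derive (y : R) 1 (fun y : R => y * c) c.
  apply: is_derive_eq (is_deriveMf (is_derive_id y 1) (is_derive_cst c y 1)) _.
  by rewrite /=; ring.
have lin' (c y : R) : is_derive (y : R) 1 (fun y : R => c * y) c.
  apply: is_derive_eq (is_deriveMf (is_derive_cst c y 1) (is_derive_id y 1)) _.
  by rewrite /=; ring.
have sf' y : is_derive (y : R) 1 f (derive1 f y) by exact: smooth_is_derive1.
pose G t := t * f (x * t).
have dG t : is_derive (t : R) 1 G ('D_(1, 0) F (x, t)).
  have HF := is_derive_fst (x : R^o) (1 : R^o) t sF.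
  have HF' : is_derive (x : R) 1 (fun s : R => F (s, t))
      (x * (derive1 f (x * t) * t) + f (x * t) * 1).
    exact: (is_deriveMf (did x)
      (@is_derive_comp1 R R^o f (fun s => s * t) 1 x _ _ (sf' _) (lin _ _))).
  have -> : 'D_(1, 0) F (x, t) = x * (derive1 f (x * t) * t) + f (x * t) * 1.
    by have [_ <-] := HF; have [_ <-] := HF'.
  apply: is_derive_eq (is_deriveMf (is_derive_id t 1)
    (@is_derive_comp1 R R^o f (fun s => x * s) 1 t _ _ (sf' _) (lin' _ _))) _.
  by ring.
rewrite (intL_derive ltr01 _ dG) /G ?mul0r ?subr0 ?mulr1 ?mul1r//.
exact: (smooth_continuous
  (smooth_slice (x : R^o) (smooth_derive (1 : R^o, 0 : R^o) sF))).
Qed.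

Lemma antiderivative_period L f H : 0 < L -> smooth_periodic L f ->
  (forall x : R, is_derive x 1 H (f x)) ->
  forall x, H (x + L) - H x = intL L f.
Proof.
move=> L_gt0 [sf pf] dH x.
rewrite (intL_derive L_gt0 _ dH); last exact: smooth_continuous1.
have -> : H L - H 0 = H (0 + L) - H 0 by rewrite add0r.
apply: (@is_derive0_eq R (fun x => H (x + L) - H x)) => y.
rewrite -(subrr (f y)) -{1}(pf y).
by apply: is_deriveBf => //; exact: is_derive_translate.
Qed.

(** If f were positive at x, an antiderivative of f, which is nondecreasing,
would increase strictly between x and x + L, whereas its total increase over a
period is the integral of f. *)
Lemma intL_eq0 L f : 0 < L -> smooth_periodic L f -> (forall x, 0 <= f x) ->
  intL L f = 0 -> forall x, f x = 0.
Proof.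
move=> L_gt0 pf f0 If x; have [sf _] := pf.
have [H dH] := antiderivative sf.
have HL : H (x + L) = H x.
  by apply/eqP; rewrite -subr_eq0 (antiderivative_period L_gt0 pf dH) If.
have ndH a b : a < b -> H a <= H b.
  move=> ab; have [c [_ E]] := mean_value ab dH.
  by rewrite -subr_ge0 E mulr_ge0// subr_ge0 ltW.
apply/eqP; rewrite eq_le f0 andbT leNgt; apply/negP => fx.
have N : nbhs x (fun y => 0 < f y).
  exact: (cvgr_gt (f x) (@smooth_continuous1 R f sf x) 0 fx).
move/nbhs_ballP: N => [d /= d0 Hd].
(* A step within the neighbourhood of x where f > 0, and shorter than a period. *)
pose e := Num.min d L / 2.
have m0 : 0 < Num.min d L by rewrite lt_min d0.
have e0 : 0 < e by rewrite divr_gt0.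
have : e < Num.min d L by rewrite /e ltr_pdivrMr// ltr_pMr// ltr1n.
rewrite lt_min => /andP[ed eL].
have [|c [/andP[xc cx] E]] := @mean_value _ H f x (x + e) _ dH.
  by rewrite ltrDl.
have fc : 0 < f c.
  apply: Hd; rewrite -ball_normE/= ltr0_norm ?subr_lt0// opprB.
  by rewrite (lt_trans _ ed)// ltrBlDl.
have : 0 < H (x + e) - H x by rewrite E addrAC subrr add0r mulr_gt0.
rewrite subr_gt0 => h1.
have h2 : H (x + e) <= H (x + L) by apply: ndH; rewrite ltrD2l.
by move: (lt_le_trans h1 h2); rewrite HL ltxx.
Qed.

End Antiderivative.

Section Nondegenerate.
Context {R : realType}.
Variables (L : R) (L_gt0 : 0 < L).
Implicit Types (g U V W : curve R) (f p q r s : R -> R).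

Lemma dx_periodic g : smoothC2 (V := R^o) g -> (forall x, g (x + L) = g x) ->
  forall x, dx g (x + L) = dx g x.
Proof.
move=> /smoothC2P sg pg x; apply: rc_eqP => k; rewrite !rc_derC2.
have [|_ H] := @periodic_derive1 R L (fun y => rc k (g y)).
  by split; [exact: sg|move=> y; rewrite pg].
by have := H x; rewrite !derive1E.
Qed.

Lemma speed_smooth_periodic g : inP L g ->
  smooth_periodic L (fun x => dot (dx g x) (dx g x)).
Proof.
move=> /inPE[sg pg _ _ _]; split.
  by apply: smooth_dot; exact: smooth_derC2.
by move=> x; rewrite (dx_periodic sg pg).
Qed.

Lemma speed_neq0 g x : inP L g -> dot (dx g x) (dx g x) != 0.
Proof. by move=> /inPE[_ _ _ g0 _]; rewrite gt_eqF// dot_gt0. Qed.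

(** Any smooth periodic r is the contact component of a tangent field, q being
determined by the tangency condition. *)
Lemma contact_lift g r : inP L g -> smooth_periodic L r ->
  exists2 V, tangentP L g V & contact g V = r.
Proof.
move=> Pg pr.
pose q x := derive1 r x * (2 * dot (dx g x) (dx g x))^-1.
pose V x := (0 : R)%:C%C *: dx g x + (q x)%:C%C *: J (dx g x) + (r x)%:C%C *: J (g x).
have nz x : 2 * dot (dx g x) (dx g x) != 0 by rewrite mulf_neq0// speed_neq0.
have H : tangent_fields L g V (fun=> 0) q r.
  split=> //; first exact: smooth_periodic_cst.
  - apply: smooth_periodicM; first exact: periodic_derive1.
    apply: smooth_periodicV => //; apply: smooth_periodicM.
      exact: smooth_periodic_cst.
    exact: speed_smooth_periodic.
  - by move=> x; rewrite /q; field; exact: speed_neq0.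
by exists V; [apply/tangentPE; exists (fun=> 0), q, r|exact: (contactE Pg H)].
Qed.

Lemma verticalD g V W : vertical L g V -> vertical L g W ->
  vertical L g (fun x => V x + W x).
Proof.
move=> [a [f [pf VE]]] [b [h [ph WE]]].
exists (a + b), (fun x => f x + h x); split; first exact: smooth_periodicD.
move=> x; rewrite VE WE -JE; move: (dx g x) (J (g x)) => X Y; apply: rc_eqP => k.
by rewrite rcD 3!rcDZ; ring.
Qed.

Lemma verticalN g V : vertical L g V -> vertical L g (fun x => - V x).
Proof.
move=> [a [f [pf VE]]].
exists (- a), (fun x => -1 * f x); split.
  by apply: smooth_periodicM => //; exact: smooth_periodic_cst.
move=> x; rewrite VE -JE; move: (dx g x) (J (g x)) => X Y; apply: rc_eqP => k.
by rewrite rcN 2!rcDZ; ring.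
Qed.

Lemma tclass_vertical g W : vertical L g W ->
  tclass L g W = tclass L g (fun=> 0).
Proof.
move=> vW; apply/seteqP; split=> V [tV vV]; split=> //.
- rewrite (_ : (fun x => V x - 0) = fun x => (V x - W x) + W x).
    exact: verticalD.
  by apply/funext => x; rewrite subr0 subrK.
- rewrite (_ : (fun x => V x - W x) = fun x => (V x - 0) + - W x).
    by apply: verticalD => //; exact: verticalN.
  by apply/funext => x; rewrite subr0.
Qed.

(** A class in the kernel is tested against a field whose contact component is
the derivative of that of W. *)
Lemma OmegaQ_nondegenerate g B : inP L g -> tangentQ L g B ->
  (forall A, tangentQ L g A -> OmegaQ L g A B = 0) ->
  B = tclass L g (fun=> 0).
Proof.
move=> Pg [W tW ->] H.
have := (tangentPE L g W).1 tW => -[p [q [s HW]]].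
have sE := contactE Pg HW; case: (HW) => pp _ ps sq WE.
have ps' := periodic_derive1 ps.
(* The test field has contact component s_x. *)
have [V tV rE] := contact_lift Pg ps'.
have := H _ (tclass_tangentQ tV).
rewrite (OmegaQ_tclass L_gt0 Pg tV tW) (OmegaP_pairing L_gt0 Pg tV tW) rE sE => I0.
have s'0 x : derive1 s x = 0.
  have := intL_eq0 L_gt0 (smooth_periodicM ps' ps') _ I0 x.
  rewrite -expr2 => /(_ _)/eqP; rewrite sqrf_eq0 => E; apply/eqP/E => y.
  by rewrite -expr2 sqr_ge0.
have q0 x : q x = 0.
  have /esym/eqP := sq x; rewrite s'0 !mulf_eq0 pnatr_eq0/=.
  by rewrite (negbTE (speed_neq0 x Pg)) orbF => /eqP.
apply: tclass_vertical; exists (s 0), p; split; first exact: pp.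
move=> x.
rewrite WE q0 (_ : s x = s 0).
  rewrite -JE; move: (dx g x) (J (g x)) => X Y.
  by apply: rc_eqP => k; rewrite !(rcD, rcZ); ring.
apply: is_derive0_eq => y; rewrite -(s'0 y).
by apply: smooth_is_derive1; case: ps.
Qed.

End Nondegenerate.

(** * Closedness on families of curves *)

(** The variables stand for the values of G and of its derivatives: X, U, V, W
for the first derivatives, Xu for the one along x and u, and so on.  The terms
with Uv, Vw and Wu cancel in pairs. *)
Lemma detR_cyclic (R : realType) (g X U V W Xu Xv Xw Uv Vw Wu : C2 R) :
  (detR U X V W + detR g Xu V W + detR g X Uv W + detR g X V Wu)
  + (detR V X W U + detR g Xv W U + detR g X Vw U + detR g X W Uv)
  + (detR W X U V + detR g Xw U V + detR g X Wu V + detR g X U Vw)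
  = (detR X U V W + detR g Xu V W + detR g U Xv W + detR g U V Xw)
    - 4 * detR X U V W.
Proof. by rewrite !detRE /minor2; ring. Qed.

#[local] Opaque derC2 derive.

Section VolumePullback.
Context {R : realType} {Z : normedModType R}.
Variables (G : Z -> C2 R) (sG : smoothC2 G).
Implicit Types (e u v w z : Z).

(** The coefficient of the pullback by G of the volume form det (G, ., ., .) of
S^3 in the directions e, v, w. *)
Definition pullvol e v w z : R :=
  detR (G z) (derC2 e G z) (derC2 v G z) (derC2 w G z).

Lemma smooth_pullvol e v w : smooth (pullvol e v w).
Proof. by apply: smooth_detR => //; exact: smooth_derC2. Qed.

Lemma derive_pullvol u e v w z : 'D_u (pullvol e v w) z =
  detR (derC2 u G z) (derC2 e G z) (derC2 v G z) (derC2 w G z)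
  + detR (G z) (derC2 u (derC2 e G) z) (derC2 v G z) (derC2 w G z)
  + detR (G z) (derC2 e G z) (derC2 u (derC2 v G) z) (derC2 w G z)
  + detR (G z) (derC2 e G z) (derC2 v G z) (derC2 u (derC2 w G) z).
Proof.
have H a : is_deriveC2 z u (derC2 a G) (derC2 u (derC2 a G) z).
  by apply: smooth_is_deriveC2; exact: smooth_derC2.
by have [] := is_derive_detR (smooth_is_deriveC2 z u sG) (H e) (H v) (H w).
Qed.

Lemma pullvol_cyclic e u v w z :
  'D_u (pullvol e v w) z + 'D_v (pullvol e w u) z + 'D_w (pullvol e u v) z =
  'D_e (pullvol u v w) z
  - 4 * detR (derC2 e G z) (derC2 u G z) (derC2 v G z) (derC2 w G z).
Proof.
rewrite [X in X + _ + _ = _]derive_pullvol [X in _ + X + _ = _]derive_pullvol.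
rewrite [X in _ + X = _]derive_pullvol [X in _ = X - _]derive_pullvol.
have S a b := derC2_sym a b z sG.
move: (S e u) (S e v) (S e w) (S u v) (S v w) (S w u).
move: (derC2 e (derC2 u G) z) (derC2 e (derC2 v G) z) (derC2 e (derC2 w G) z)
  (derC2 v (derC2 u G) z) (derC2 w (derC2 v G) z) (derC2 u (derC2 w G) z).
move=> Xu Xv Xw Uv Vw Wu -> -> -> <- <- <-.
exact: detR_cyclic.
Qed.

End VolumePullback.

Lemma OmegaPE (R : realType) (L : R) (g V W : curve R) : OmegaP L g V W =
  - intL L (fun x => detR (g x) (dx g x) (V x) (W x)).
Proof. by []. Qed.

Section Families.
Context {R : realType} {V : normedModType R}.
Variables (L : R) (L_gt0 : 0 < L).
Variable G : V -> curve R.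
Hypothesis sG : smoothC2 (fun z : V * R^o => G z.1 z.2).
Implicit Types (s u v w : V).

Let Gz (z : V * R^o) := G z.1 z.2.
Let hor v : V * R^o := (v, 0).
Let ver : V * R^o := (0, 1).

Lemma dx_family s x : dx (G s) x = derC2 ver Gz (s, x).
Proof.
apply: is_derive_derC2 => k.
have := is_derive_snd s x ((smoothC2P _).1 sG k).
by rewrite rc_derC2.
Qed.

Lemma dv_family v s x : derC2 v (fun s => G s x) s = derC2 (hor v) Gz (s, x).
Proof.
apply: is_derive_derC2 => k.
have := is_derive_fst s v x ((smoothC2P _).1 sG k).
by rewrite rc_derC2.
Qed.

Definition family_form v w s : R :=
  OmegaP L (G s) (fun x => derC2 v (fun s => G s x) s)
    (fun x => derC2 w (fun s => G s x) s).

Lemma family_formE v w s :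
  family_form v w s = - intL L (fun x => pullvol Gz ver (hor v) (hor w) (s, x)).
Proof.
apply: etrans (OmegaPE _ _ _ _) _; apply: (congr1 (fun t => - t)).
apply: eq_intL => x.
rewrite /pullvol -(dx_family s x) -(dv_family v s x) -(dv_family w s x).
by [].
Qed.

Lemma smooth_family_form v w : smooth (family_form v w).
Proof.
apply: (eq_smooth (fun s => esym (family_formE v w s))).
by apply: smoothN; apply: smooth_intL => //; exact: smooth_pullvol.
Qed.

Lemma derive_family_form u v w s : 'D_u (family_form v w) s =
  - intL L (fun x => 'D_(hor u) (pullvol Gz ver (hor v) (hor w)) (s, x)).
Proof.
have H := is_deriveN
  (is_derive_intL L_gt0 s u (smooth_pullvol sG ver (hor v) (hor w))).
by have [] := eq_is_derive (fun s => esym (family_formE v w s)) H.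
Qed.

(** The cyclic sum is an integral over [0, L] of the right-hand side of
[pullvol_cyclic]; its exact part drops out by periodicity. *)
Lemma family_form_closed u v w s : (forall s x, G s (x + L) = G s x) ->
  (forall x, detR (dx (G s) x) (derC2 u (fun s => G s x) s)
    (derC2 v (fun s => G s x) s) (derC2 w (fun s => G s x) s) = 0) ->
  'D_u (family_form v w) s + 'D_v (family_form w u) s
  + 'D_w (family_form u v) s = 0.
Proof.
move=> pG d0.
rewrite [X in X + _ + _]derive_family_form [X in _ + X + _]derive_family_form.
rewrite [X in _ + X]derive_family_form -!opprD.
have c F : smooth F -> continuous (fun x : R => F (s, x : R^o)).
  by move=> sF; exact: (smooth_continuous (smooth_slice s sF)).
pose F a b d z := 'D_(hor a) (pullvol Gz ver (hor b) (hor d)) z.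
have sF a b d : smooth (F a b d).
  by apply: smooth_derive; exact: smooth_pullvol.
have cF a b d := c _ (sF a b d).
have cFF : continuous (fun x : R => F u v w (s, x) + F v w u (s, x)).
  by move=> x; apply: cvgD; [exact: (cF u v w x)|exact: (cF v w u x)].
apply: etrans (_ : - (intL L (fun x => F u v w (s, x)) +
    intL L (fun x => F v w u (s, x)) + intL L (fun x => F w u v (s, x))) = 0) => //.
rewrite -(intLD L (cF u v w) (cF v w u)) -(intLD L cFF (cF w u v)).
pose E := pullvol Gz (hor u) (hor v) (hor w).
have sE : smooth E by exact: smooth_pullvol.
rewrite (_ : intL L _ = intL L (fun x => 'D_ver E (s, x))); last first.
  apply: eq_intL => x; rewrite pullvol_cyclic// -!dx_family -!dv_family d0.
  by rewrite mulr0 subr0.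
rewrite (intL_derive L_gt0 _ (fun x => is_derive_snd s x sE)); last first.
  exact: (c _ (smooth_derive ver sE)).
have pE (x : R) : E (s, x + L) = E (s, x).
  have GL s' : G s' (x + L) = G s' x by exact: pG.
  have dL a : derC2 (hor a) Gz (s, x + L) = derC2 (hor a) Gz (s, x).
    by rewrite -!dv_family; congr (derC2 a _ s); apply/funext.
  by rewrite /E /pullvol !dL /Gz /= GL.
by rewrite -[L in E (s, L)]add0r pE subrr oppr0.
Qed.

End Families.

(** * Tangent vectors of families and the exterior derivative *)

Lemma is_derive_const0 (R : realType) (V : normedModType R) (F : V -> R) (c : R)
    z v df : (forall y, F y = c) -> is_derive z v F df -> df = 0.
Proof.
move=> Fc H; have H0 := eq_is_derive (fun y => esym (Fc y)) (is_derive_cst c z v).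
by have [_ <-] := H; have [_ <-] := H0.
Qed.

Section FamilyTangent.
Context {R : realType} {V : normedModType R}.
Variables (L : R) (G : V -> curve R).
Hypothesis sG : smoothC2 (fun z : V * R^o => G z.1 z.2).
Hypothesis PG : forall s, inP L (G s).

(** Differentiating <G, G> = 1 along v shows that the variation field U of the
family is orthogonal to G, hence a combination of G_x, i G_x and i G.
Differentiating <G_x, i G> = 0 along v gives <U_x, i G> = <U, i G_x>, so that the
contact component r = <U, i G> satisfies r_x = 2 <U, i G_x>, which is the
tangency condition. *)
Lemma family_tangent v s : tangentP L (G s) (fun x => derC2 v (fun s => G s x) s).
Proof.
pose Gz (z : V * R^o) := G z.1 z.2; pose h : V * R^o := (v, 0).
pose e : V * R^o := (0, 1).
pose U := derC2 h Gz; pose X := derC2 e Gz.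
have sU : smoothC2 U by exact: smooth_derC2.
have sX : smoothC2 X by exact: smooth_derC2.
have dE s' x : dx (G s') x = X (s', x) by exact: dx_family.
have vE x : derC2 v (fun s => G s x) s = U (s, x) by exact: dv_family.
have g1 z : dot (Gz z) (Gz z) = 1.
  by have [_ _ H _ _] := (inPE L _).1 (PG z.1); exact: H.
have gX z : dot (X z) (Gz z) = 0 /\ dot (X z) (J (Gz z)) = 0.
  case: z => s' x; have [_ _ _ _ H] := (inPE L _).1 (PG s').
  by have := H x; rewrite dE.
have dG a z := smooth_is_deriveC2 z a sG.
(* The derivative of <G, G> = 1 along v. *)
have Ug z : dot (U z) (Gz z) = 0.
  have H := is_derive_const0 g1 (is_derive_dot (dG h z) (dG h z)).
  move: H; rewrite (dotC (Gz z)) -mulr2n => /eqP; rewrite mulrn_eq0/= => /eqP.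
  exact.
(* The derivative of <X, i G> = 0 along v. *)
have XU z : dot (derC2 h X z) (J (Gz z)) = dot (U z) (J (X z)).
  have gX2 y : dot (X y) (J (Gz y)) = 0 by exact: (gX y).2.
  have H := is_derive_const0 gX2
    (is_derive_dot (smooth_is_deriveC2 z h sX) (is_deriveC2J (dG h z))).
  apply/eqP; rewrite -subr_eq0 -[X in _ == X]H; apply/eqP; congr (_ + _).
  by rewrite [in RHS]dotJ [in RHS]dotC.
pose N z := dot (X z) (X z).
have N0 z : N z != 0.
  case: z => s' x; have [_ _ _ H _] := (inPE L _).1 (PG s').
  by rewrite gt_eqF// dot_gt0// -dE; exact: H.
have pG x : G s (x + L) = G s x by have [_ H _ _ _] := (inPE L _).1 (PG s).
have pX (x : R) : X (s, x + L) = X (s, x).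
  rewrite -!dE; apply: dx_periodic => //.
  by have [] := (inPE L _).1 (PG s).
have pU (x : R) : U (s, x + L) = U (s, x).
  rewrite -!vE; congr (derC2 v _ s); apply/funext => s'.
  by have [_ H _ _ _] := (inPE L _).1 (PG s').
have sJG : smoothC2 (fun z => J (Gz z)) by exact: smoothC2J.
have sN : smooth (fun z => (N z)^-1) by apply: smoothV => //; exact: smooth_dot.
pose r z := dot (U z) (J (Gz z)).
have sr : smooth r by exact: smooth_dot.
apply/tangentPE.
exists (fun x => dot (U (s, x)) (X (s, x)) / N (s, x)),
  (fun x => dot (U (s, x)) (J (X (s, x))) / N (s, x)), (fun x => r (s, x)).
split.
- split; last by move=> x; rewrite /N pU pX.
  apply: (smooth_slice s (F := fun z => dot (U z) (X z) / N z)).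
  by apply: smoothM => //; exact: smooth_dot.
- split; last by move=> x; rewrite /N pU pX.
  apply: (smooth_slice s (F := fun z => dot (U z) (J (X z)) / N z)).
  by apply: smoothM => //; apply: smooth_dot => //; exact: smoothC2J.
- split; last by move=> x; rewrite /r /Gz /= pU pG.
  exact: smooth_slice.
- move=> x; rewrite dE -/(N _).
  rewrite (is_derive_derive1 (is_derive_snd s x sr)).
  have Hr := is_derive_dot (smooth_is_deriveC2 (s, x : R^o) e sU)
    (is_deriveC2J (dG e (s, x : R^o))).
  have [_ ->] := Hr.
  rewrite (derC2_sym h e _ sG) XU -mulrA divfK//.
  by rewrite mulr2n mulrDl mul1r.
- move=> x; rewrite vE dE.
  have [Xg XJg] := gX (s, x).
  have X0 : X (s, x) != 0.
    by apply/eqP => X0; move: (N0 (s, x)); rewrite /N X0 /dot !rc0 !mul0r !addr0 eqxx.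
  exact: (orthogonal_decomposition (g1 (s, x)) Xg XJg X0 (Ug (s, x))).
Qed.

End FamilyTangent.

Section ExteriorDerivative.
Context {R : realType}.
Variables (L : R) (L_gt0 : 0 < L).
Variables (g U V W : curve R).
Hypothesis Pg : inP L g.
Hypothesis tU : tangentP L g U.
Hypothesis tV : tangentP L g V.
Hypothesis tW : tangentP L g W.

Lemma tangent_smooth Y : tangentP L g Y -> smoothC2 (V := R^o) Y.
Proof.
move=> /tangentPE[p [q [r [[sp _] [sq _] [sr _] _ YE]]]].
have [sg _ _ _ _] := (inPE L g).1 Pg.
have sX : smoothC2 (V := R^o) (dx g) by exact: smooth_derC2.
apply: (eq_smoothC2 (fun x => esym (YE x))).
apply: smoothC2D; last by apply: smoothC2Z => //; exact: smoothC2J.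
by apply: smoothC2D; apply: smoothC2Z => //; exact: smoothC2J.
Qed.

Lemma tangent_periodic Y x : tangentP L g Y -> Y (x + L) = Y x.
Proof.
move=> /tangentPE[p [q [r [[_ pp] [_ pq] [_ pr] _ YE]]]].
have [sg pg _ _ _] := (inPE L g).1 Pg.
by rewrite !YE pp pq pr (dx_periodic sg pg) pg.
Qed.

Lemma tangent_orthogonal Y x : tangentP L g Y -> dot (Y x) (g x) = 0.
Proof.
move=> /tangentPE[p [q [r [_ _ _ _ YE]]]].
have [_ _ _ _ gg] := (inPE L g).1 Pg; have [Xg XJg] := gg x.
rewrite YE !dotD !dotZ Xg -[dot (J (dx g x)) _]opprK -dotJ XJg.
by rewrite -[dot (J (g x)) _]opprK -dotJ dotuJ !(oppr0, mulr0, addr0).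
Qed.

Let S := (R^o * R^o * R^o)%type.
Let G (s : S) : curve R := fun x =>
  g x + (s.1.1)%:C%C *: U x + (s.1.2)%:C%C *: V x + (s.2)%:C%C *: W x.

Lemma is_derive_linear (T : normedModType R) (l : T -> R) x v :
  (forall (h : R) w y, l (h *: w + y) = h * l w + l y) ->
  is_derive x v l (l v).
Proof.
move=> lE.
by have := @is_derive_affine R T R^o l l id x v (l v) lE (is_derive_id _ _).
Qed.

Lemma smooth_plane : smoothC2 (fun z : S * R^o => G z.1 z.2).
Proof.
have [sg _ _ _ _] := (inPE L g).1 Pg.
have snd_smooth Y : smoothC2 (V := R^o) Y -> smoothC2 (fun z : S * R^o => Y z.2).
  move=> /smoothC2P sY; apply/smoothC2P => k.
  exact: (smooth_snd _ (sY k)).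
have id_smooth := @smooth_id R.
apply: smoothC2D; [apply: smoothC2D; [apply: smoothC2D|]|].
- exact: snd_smooth.
- apply: smoothC2Z; last by apply: snd_smooth; exact: tangent_smooth.
  exact: (smooth_fst _ (smooth_fst _ (smooth_fst _ id_smooth))).
- apply: smoothC2Z; last by apply: snd_smooth; exact: tangent_smooth.
  exact: (smooth_fst _ (smooth_fst _ (smooth_snd _ id_smooth))).
- apply: smoothC2Z; last by apply: snd_smooth; exact: tangent_smooth.
  exact: (smooth_fst _ (smooth_snd _ id_smooth)).
Qed.

Lemma derC2_plane (v s : S) x : derC2 v (fun s => G s x) s =
  (v.1.1)%:C%C *: U x + (v.1.2)%:C%C *: V x + (v.2)%:C%C *: W x.
Proof.
apply: is_derive_derC2 => k.
pose l (s : S) := s.1.1 * rc k (U x) + s.1.2 * rc k (V x) + s.2 * rc k (W x).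
have H : is_derive s v l (l v).
  by apply: is_derive_linear => h w y; rewrite /l /= /GRing.scale /=; ring.
have H' := is_deriveDf (is_derive_cst (rc k (g x)) s v) H.
have E (y : S) := rcDDZ3 k y.1.1 y.1.2 y.2 (g x) (U x) (V x) (W x).
have H'' := eq_is_derive (fun y => esym (E y)) H'.
by apply: is_derive_eq H'' _; rewrite add0r; exact/esym/rcDZ3.
Qed.

Let e1 : S := (1, 0, 0).
Let e2 : S := (0, 1, 0).
Let e3 : S := (0, 0, 1).

Let dU s : (fun x => derC2 e1 (fun s => G s x) s) = U.
Proof.
apply/funext => x; rewrite derC2_plane /=.
by apply: rc_eqP => k; rewrite rcDZ3; ring.
Qed.

Let dV s : (fun x => derC2 e2 (fun s => G s x) s) = V.
Proof.
apply/funext => x; rewrite derC2_plane /=.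
by apply: rc_eqP => k; rewrite rcDZ3; ring.
Qed.

Let dW s : (fun x => derC2 e3 (fun s => G s x) s) = W.
Proof.
apply/funext => x; rewrite derC2_plane /=.
by apply: rc_eqP => k; rewrite rcDZ3; ring.
Qed.

Lemma derive1_line (P : S -> R) (e : S) (f : R -> R) : smooth P ->
  (forall t, f t = P (t *: e + 0)) -> derive1 f 0 = 'D_e P 0.
Proof.
move=> sP fE; apply: is_derive_derive1.
apply: eq_is_derive ((is_derive_lineP _ _ _ _).1 (smooth_is_derive 0 e sP)) => t.
by rewrite fE.
Qed.

Let axisE (t : R) : [/\ G (t *: e1 + 0) = fun x => g x + t%:C%C *: U x,
   G (t *: e2 + 0) = (fun x => g x + t%:C%C *: V x) &
   G (t *: e3 + 0) = fun x => g x + t%:C%C *: W x].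
Proof.
split; apply/funext => x; rewrite /G /= /GRing.scale /= !mulr0 !mulr1 !addr0;
  apply: rc_eqP => k; rewrite rcDDZ3 rcD rcZ; ring.
Qed.

(** The three terms of the exterior derivative are the derivatives at 0, along
the coordinate axes, of the coefficients of the form on the affine family G. *)
Lemma ext_der_OmegaP : ext_der (OmegaP L) g U V W = 0.
Proof.
have sG := smooth_plane; pose P := family_form L G.
have G0 : G 0 = g.
  apply/funext => x; rewrite /G /=; apply: rc_eqP => k.
  by rewrite rcDDZ3; ring.
have pG (s : S) x : G s (x + L) = G s x.
  have [_ pg _ _ _] := (inPE L g).1 Pg.
  by rewrite /G pg !tangent_periodic.
have [_ _ g1 _ gg] := (inPE L g).1 Pg.
have := family_form_closed L_gt0 sG (u := e1) (v := e2) (w := e3) (s := 0) pG.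
have d0 x : detR (dx (G 0) x) (derC2 e1 (fun s => G s x) 0)
    (derC2 e2 (fun s => G s x) 0) (derC2 e3 (fun s => G s x) 0) = 0.
  have -> : derC2 e1 (fun s => G s x) 0 = U x.
    by rewrite -[RHS](congr1 (fun F => F x) (dU 0)).
  have -> : derC2 e2 (fun s => G s x) 0 = V x.
    by rewrite -[RHS](congr1 (fun F => F x) (dV 0)).
  have -> : derC2 e3 (fun s => G s x) 0 = W x.
    by rewrite -[RHS](congr1 (fun F => F x) (dW 0)).
  rewrite G0; exact: (detR_orthogonal (g1 x) (gg x).1 (tangent_orthogonal x tU)
    (tangent_orthogonal x tV) (tangent_orthogonal x tW)).
move=> /(_ d0) <-.
have sP v w : smooth (P v w) by exact: smooth_family_form.
have E1 : derive1 (fun t : R => OmegaP L (fun x => g x + t%:C%C *: U x) V W) 0 =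
    'D_e1 (P e2 e3) 0.
  apply: (derive1_line (sP e2 e3)) => t.
  have PE s : P e2 e3 s = OmegaP L (G s) V W.
    exact: (congr2 (OmegaP L (G s)) (dV s) (dW s)).
  have [A1 A2 A3] := axisE t.
  exact: (etrans (congr1 (fun h => OmegaP L h V W) (esym A1)) (esym (PE _))).
have E2 : derive1 (fun t : R => OmegaP L (fun x => g x + t%:C%C *: V x) W U) 0 =
    'D_e2 (P e3 e1) 0.
  apply: (derive1_line (sP e3 e1)) => t.
  have PE s : P e3 e1 s = OmegaP L (G s) W U.
    exact: (congr2 (OmegaP L (G s)) (dW s) (dU s)).
  have [A1 A2 A3] := axisE t.
  exact: (etrans (congr1 (fun h => OmegaP L h W U) (esym A2)) (esym (PE _))).
have E3 : derive1 (fun t : R => OmegaP L (fun x => g x + t%:C%C *: W x) U V) 0 =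
    'D_e3 (P e1 e2) 0.
  apply: (derive1_line (sP e1 e2)) => t.
  have PE s : P e1 e2 s = OmegaP L (G s) U V.
    exact: (congr2 (OmegaP L (G s)) (dU s) (dV s)).
  have [A1 A2 A3] := axisE t.
  exact: (etrans (congr1 (fun h => OmegaP L h U V) (esym A3)) (esym (PE _))).
exact: (congr2 +%R (congr2 +%R E1 E2) E3).
Qed.

End ExteriorDerivative.

(** * Invariance under rotations and reparametrizations *)

Section Flow.
Context {R : realType}.
Variables (L : R) (L_gt0 : 0 < L).
Implicit Types (f u v : R -> R).

Lemma periodic_bounded f : smooth_periodic L f -> exists K, forall x, `|f x| <= K.
Proof.
move=> [sf pf]; have cf := smooth_continuous1 sf.
have ca : {within `[0, L], continuous (fun x => `|f x|)}.
  apply: continuous_subspaceT => x.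
  apply: (@continuous_comp _ _ _ f Num.norm); [exact: cf|exact: norm_continuous].
have [c _ Hc] := EVT_max (ltW L_gt0) ca.
exists `|f c| => x.
pose n := Num.floor (x / L).
have pz (m : int) y : f (y + m%:~R * L) = f y.
  have pn (k : nat) z : f (z + k%:R * L) = f z.
    elim: k => [|k IH]; first by rewrite mul0r addr0.
    by rewrite -natr1 mulrDl mul1r addrA pf.
  case: m => k; first exact: pn.
  rewrite -(pn k.+1 (y + (Negz k)%:~R * L)) NegzE mulrNz mulNr.
  by rewrite subrK.
rewrite -(subrK (n%:~R * L) x) pz; apply: Hc.
rewrite in_itv/= subr_ge0 -ler_pdivlMr// floor_le/= lerBlDl.
rewrite -{2}[L]mul1r -mulrDl -ler_pdivrMr// -[1]/(1%:~R) -rmorphD/=.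
exact/ltW/floorD1_gt.
Qed.

(** The function w exp (- K t) is nonincreasing and w exp (K t) is
nondecreasing. *)
Lemma gronwall_zero (w dw : R -> R) (K : R) :
  (forall t : R, is_derive t 1 w (dw t)) -> (forall t, 0 <= w t) ->
  (forall t, `|dw t| <= K * w t) -> w 0 = 0 -> forall t, w t = 0.
Proof.
move=> H w0 dwK w00 t; apply/eqP; rewrite eq_le w0 andbT.
have dE k s : is_derive (s : R) 1 (fun y => w y * expR (k * y))
    ((dw s + k * w s) * expR (k * s)).
  have Hk : is_derive (s : R) 1 (fun y => k * y) k.
    apply: is_derive_eq (is_deriveMf (is_derive_cst k s 1) (is_derive_id s 1)) _.
    by rewrite /=; ring.
  have He := @is_derive_comp1 R R^o expR (fun y => k * y) 1 s _ _ (is_derive_expR _) Hk.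
  apply: is_derive_eq (is_deriveMf (H s) He) _.
  by ring.
have expP y := expR_gt0 (y : R).
have [t0|t0|->] := ltgtP t 0; last by rewrite w00.
- have [c [_]] := mean_value t0 (dE K).
  rewrite w00 mul0r !sub0r => E.
  have h : 0 <= (dw c + K * w c) * expR (K * c) * - t.
    rewrite mulr_ge0 ?oppr_ge0 ?(ltW t0)// mulr_ge0 ?(ltW (expP _))//.
    by have := dwK c; rewrite ler_norml => /andP[]; lra.
  by move: h; rewrite -E oppr_ge0 pmulr_lle0.
- have [c [_]] := mean_value t0 (dE (- K)).
  rewrite w00 mul0r !subr0 => E.
  have h : (dw c + - K * w c) * expR (- K * c) * t <= 0.
    rewrite mulr_le0_ge0 ?(ltW t0)// mulr_le0_ge0 ?(ltW (expP _))//.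
    by have := dwK c; rewrite ler_norml => /andP[]; lra.
  by move: h; rewrite -E pmulr_lle0.
Qed.

(** A periodic smooth f is Lipschitz, so the square of the difference of two
solutions satisfies the hypothesis of [gronwall_zero]. *)
Lemma ode_unique f u v : smooth_periodic L f ->
  (forall t : R, is_derive t 1 u (f (u t))) ->
  (forall t : R, is_derive t 1 v (f (v t))) -> u 0 = v 0 -> u =1 v.
Proof.
move=> pf Hu Hv uv0; have [sf _] := pf.
have [K HK] := periodic_bounded (periodic_derive1 pf).
have lip a b : `|f a - f b| <= K * `|a - b|.
  have W x y : x < y -> `|f y - f x| <= K * `|y - x|.
    move=> /mean_value /(_ (fun x => smooth_is_derive1 x sf))[c [_ ->]].
    by rewrite normrM ler_wpM2r.
  have [/W|/W|->] := ltgtP a b; last by rewrite !subrr normr0 mulr0.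
    by rewrite distrC (distrC b).
  by [].
pose w t := (u t - v t) * (u t - v t).
have dw t : is_derive (t : R) 1 w (2 * (u t - v t) * (f (u t) - f (v t))).
  have H := is_deriveBf (Hu t) (Hv t).
  by apply: is_derive_eq (is_deriveMf H H) _; ring.
have w0 t : 0 <= w t by rewrite /w -expr2 sqr_ge0.
have dwK t : `|2 * (u t - v t) * (f (u t) - f (v t))| <= 2 * K * w t.
  have -> : w t = `|u t - v t| * `|u t - v t|.
    by rewrite -normrM ger0_norm// w0.
  rewrite !normrM (ger0_norm (ler0n _ 2)) -!mulrA ler_wpM2l//.
  by rewrite mulrCA ler_wpM2l.
have w00 : w 0 = 0 by rewrite /w uv0 subrr mul0r.
move=> t; have /eqP := gronwall_zero dw w0 dwK w00 t.
by rewrite /w mulf_eq0 orbb subr_eq0 => /eqP.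
Qed.

(** By uniqueness Phi_s (Phi_t x) = Phi_(s + t) x, so Phi_(- t) is a smooth
inverse of Phi_t, and the derivative of Phi_t does not vanish.  Also by
uniqueness, Phi_t (x) + L, which solves the equation since f has period L, is
Phi_t (x + L). *)
Lemma flow_diffeo f (Phi : R -> R -> R) t : smooth_periodic L f ->
  is_flow f Phi -> [/\ smooth (Phi t : R^o -> R),
    forall x, Phi t (x + L) = Phi t x + L & forall x, derive1 (Phi t) x != 0].
Proof.
move=> pf [sPhi Phi0 dPhi]; have [sf perf] := pf.
have sP s : smooth (Phi s : R^o -> R) by exact: (smooth_slice (s : R^o) sPhi).
have dP s x : is_derive (s : R) 1 (fun s => Phi s x) (f (Phi s x)) by exact: dPhi.
have group x s : Phi s (Phi t x) = Phi (s + t) x.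
  have H1 y : is_derive (y : R) 1 (fun s => Phi s (Phi t x)) (f (Phi y (Phi t x))).
    exact: dP.
  have H2 y : is_derive (y : R) 1 (fun s => Phi (s + t) x) (f (Phi (y + t) x)).
    by apply: (is_derive_translate (f := fun s => Phi s x)); exact: dP.
  by apply: (ode_unique pf H1 H2); rewrite Phi0 add0r.
split=> [//|x|x].
- have H2 y : is_derive (y : R) 1 (fun s => Phi s x + L) (f (Phi y x + L)).
    rewrite perf -[f _]addr0.
    exact: (is_deriveDf (dP y x) (is_derive_cst L y 1)).
  by apply: (ode_unique pf (fun y => dP y (x + L)) H2); rewrite !Phi0.
- apply/eqP => d0.
  have H := @is_derive_comp1 R R^o (Phi (- t)) (Phi t) 1 x _ _
    (smooth_is_derive1 _ (sP (- t))) (smooth_is_derive1 x (sP t)).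
  have H1 : is_derive (x : R) 1 (fun y => Phi (- t) (Phi t y)) 1.
    have E (y : R) : y = Phi (- t) (Phi t y) by rewrite group addNr Phi0.
    exact: (@eq_is_derive R R^o _ _ x 1 1 E (is_derive_id x 1)).
  have : (1 : R) = 0.
    by have [_ <-] := H1; have [_ ->] := H; rewrite d0 mulr0.
  by apply/eqP; rewrite oner_eq0.
Qed.

End Flow.

Section Gauge.
Context {R : realType}.
Variables (L : R) (L_gt0 : 0 < L).
Implicit Types (g U V W : curve R) (f p q r s : R -> R).

Section Rotation.
Variables (c d : R) (cd1 : c * c + d * d = 1).
Let rot (u : C2 R) : C2 R := (c +i* d)%C *: u.

Lemma rotE u : rot u = c%:C%C *: u + d%:C%C *: J u.
Proof.
rewrite /rot JE scalerA -scalerDl; congr (_ *: u).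
by apply/eqP; rewrite eq_complex /=; apply/andP; split; apply/eqP; ring.
Qed.

Lemma dot_rot u v : dot (rot u) (rot v) = dot u v.
Proof.
transitivity ((c * c + d * d) * dot u v); last by rewrite cd1 mul1r.
by rewrite !rotE /dot !rcDZ !rcJ; ring.
Qed.

Lemma rotJ u : rot (J u) = J (rot u).
Proof. by rewrite /rot !JE !scalerA mulrC. Qed.

Lemma rotZ (a : R) u : rot (a%:C%C *: u) = a%:C%C *: rot u.
Proof. by rewrite /rot !scalerA mulrC. Qed.

Lemma rotD3 u v w : rot (u + v + w) = rot u + rot v + rot w.
Proof. by rewrite /rot !scalerDr. Qed.

Lemma dx_rot g x : smoothC2 (V := R^o) g -> dx (fun x => rot (g x)) x = rot (dx g x).
Proof.
move=> sg; apply: is_derive_derC2.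
have H := @smooth_is_deriveC2 R R^o g x 1 sg.
move=> k; have D := is_deriveDf (is_deriveMf (is_derive_cst c (x : R^o) 1) (H k))
  (is_deriveMf (is_derive_cst d (x : R^o) 1) (is_deriveC2J H k)).
apply: eq_is_derive (is_derive_eq D _) => [y|]; first by rewrite rotE rcDZ.
by rewrite rotE rcDZ /= !mulr0 !addr0.
Qed.

Lemma rotation_invariant g V W : inP L g -> tangentP L g V -> tangentP L g W ->
  [/\ inP L (fun x => rot (g x)), tangentP L (fun x => rot (g x)) (fun x => rot (V x)),
    tangentP L (fun x => rot (g x)) (fun x => rot (W x)) &
    OmegaP L (fun x => rot (g x)) (fun x => rot (V x)) (fun x => rot (W x)) =
    OmegaP L g V W].
Proof.
move=> Pg tV tW; have [sg pg g1 g0 gg] := (inPE L g).1 Pg.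
have dxE x : dx (fun x => rot (g x)) x = rot (dx g x) by exact: dx_rot.
have Prg : inP L (fun x => rot (g x)).
  apply/inPE; split.
  - apply: (eq_smoothC2 (fun x => esym (rotE (g x)))).
    apply: smoothC2D; apply: smoothC2Z; [exact: smooth_cst| |exact: smooth_cst|].
      exact: sg.
    exact: smoothC2J.
  - by move=> x; rewrite pg.
  - by move=> x; rewrite dot_rot.
  - move=> x; rewrite dxE; apply/eqP => X0.
    have := dot_gt0 (g0 x); rewrite -dot_rot X0 /dot !rc0 !mul0r !addr0.
    by rewrite ltxx.
  - by move=> x; rewrite dxE -rotJ !dot_rot; exact: gg.
have tang Y : tangentP L g Y -> tangentP L (fun x => rot (g x)) (fun x => rot (Y x)).
  move=> /tangentPE[p [q [r [pp pq pr rE YE]]]]; apply/tangentPE.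
  exists p, q, r; split; [exact: pp|exact: pq|exact: pr| |].
    by move=> x; rewrite dxE dot_rot.
  by move=> x; rewrite dxE YE rotD3 !rotZ !rotJ.
have ctE Y : contact (fun x => rot (g x)) (fun x => rot (Y x)) = contact g Y.
  by apply/funext => x; rewrite /contact -rotJ dot_rot.
split; [exact: Prg|exact: tang|exact: tang|].
rewrite (OmegaP_pairing L_gt0 Prg (tang _ tV) (tang _ tW)) !ctE.
by rewrite (OmegaP_pairing L_gt0 Pg tV tW).
Qed.

End Rotation.

Section Reparametrization.
Variables (phi : R -> R).
Hypothesis sphi : smooth (phi : R^o -> R).
Hypothesis phiL : forall x, phi (x + L) = phi x + L.
Hypothesis dphi : forall x, derive1 phi x != 0.

Lemma dphi_smooth_periodic : smooth_periodic L (derive1 phi).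
Proof.
split; first exact: smooth_derive1.
move=> x; apply/esym/is_derive_derive1.
have H := is_derive_translate (smooth_is_derive1 (x + L) sphi).
have E y : phi (y + L) - L = phi y by rewrite phiL addrK.
apply: (@eq_is_derive R R^o) E _; rewrite -[derive1 _ _]subr0.
exact: (is_deriveBf H (is_derive_cst L x 1)).
Qed.

Lemma smooth_periodic_comp f : smooth_periodic L f ->
  smooth_periodic L (fun x => f (phi x)).
Proof.
move=> [sf pf]; split; first exact: smooth_comp.
by move=> x; rewrite phiL pf.
Qed.

Lemma is_derive_comp_phi f x df : is_derive (phi x : R) 1 f df ->
  is_derive (x : R) 1 (fun y => f (phi y)) (df * derive1 phi x).
Proof.
move=> H; exact: (@is_derive_comp1 R R^o f phi 1 x _ _ H (smooth_is_derive1 x sphi)).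
Qed.

Lemma dx_comp g x : smoothC2 (V := R^o) g ->
  dx (fun x => g (phi x)) x = (derive1 phi x)%:C%C *: dx g (phi x).
Proof.
move=> sg; apply: is_derive_derC2 => k; rewrite rcZ mulrC.
have := @smooth_is_deriveC2 R R^o g (phi x) 1 sg k.
exact: is_derive_comp_phi.
Qed.

(** With H an antiderivative of r s_x, the left side is
H (phi L) - H (phi 0) = H (phi 0 + L) - H (phi 0), the integral of r s_x over a
period; no sign of the derivative of phi enters. *)
Lemma pairing_comp r s : smooth_periodic L r -> smooth_periodic L s ->
  pairing L (fun x => r (phi x)) (fun x => s (phi x)) = pairing L r s.
Proof.
move=> pr ps; have pF := smooth_periodicM pr (periodic_derive1 ps).
have [[sF _] [ss _]] := (pF, ps).
have [H dH] := antiderivative sF.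
have dHphi x := is_derive_comp_phi (dH (phi x)).
rewrite /pairing -(antiderivative_period L_gt0 pF dH (phi 0)) -phiL add0r.
rewrite -(intL_derive L_gt0 _ dHphi).
  apply: eq_intL => x.
  have -> := is_derive_derive1 (is_derive_comp_phi (smooth_is_derive1 (phi x) ss)).
  by rewrite mulrA.
apply: smooth_continuous1; apply: smoothM; first exact: (smooth_comp sF).
exact: smooth_derive1.
Qed.

(** The coefficients of V o phi at g o phi are p / phi', q / phi' and r,
all composed with phi. *)
Lemma reparametrization_invariant g V W : inP L g -> tangentP L g V -> tangentP L g W ->
  [/\ inP L (fun x => g (phi x)),
    tangentP L (fun x => g (phi x)) (fun x => V (phi x)),
    tangentP L (fun x => g (phi x)) (fun x => W (phi x)) &
    OmegaP L (fun x => g (phi x)) (fun x => V (phi x)) (fun x => W (phi x)) =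
    OmegaP L g V W].
Proof.
move=> Pg tV tW; have [sg pg g1 g0 gg] := (inPE L g).1 Pg.
have dxE x : dx (fun x => g (phi x)) x = (derive1 phi x)%:C%C *: dx g (phi x).
  exact: dx_comp.
have Pgp : inP L (fun x => g (phi x)).
  apply/inPE; split.
  - move/smoothC2P: sg => sg; apply/smoothC2P => k.
    exact: (smooth_comp (sg k) sphi).
  - by move=> x; rewrite phiL pg.
  - by move=> x; exact: g1.
  - move=> x; rewrite dxE scaler_eq0 negb_or g0 andbT.
    apply/eqP => /(congr1 (@complex.Re _)) /= d0.
    by have := dphi x; rewrite d0 eqxx.
  - by move=> x; rewrite dxE !dotZ; have [-> ->] := gg (phi x); rewrite !mulr0.
have tang Y : tangentP L g Y ->
    tangentP L (fun x => g (phi x)) (fun x => Y (phi x)).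
  move=> /tangentPE[p [q [r [pp pq pr rE YE]]]]; apply/tangentPE.
  have pd := smooth_periodicV dphi dphi_smooth_periodic.
  exists (fun x => p (phi x) * (derive1 phi x)^-1),
    (fun x => q (phi x) * (derive1 phi x)^-1), (fun x => r (phi x)); split.
  - by apply: smooth_periodicM => //; exact: smooth_periodic_comp.
  - by apply: smooth_periodicM => //; exact: smooth_periodic_comp.
  - exact: smooth_periodic_comp.
  - move=> x; have [sr _] := pr.
    rewrite (is_derive_derive1 (is_derive_comp_phi (smooth_is_derive1 (phi x) sr))).
    by rewrite rE dxE dotZ dotC dotZ; field; exact: dphi.
  - move=> x; rewrite YE dxE; move: (dx g (phi x)) (J (g (phi x))) => X Y0.
    have JZ (a : R) : J (a%:C%C *: X) = a%:C%C *: J X.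
      by rewrite !JE !scalerA mulrC.
    have ZK (a : R) (u : C2 R) :
        (a * (derive1 phi x)^-1)%:C%C *: ((derive1 phi x)%:C%C *: u) = a%:C%C *: u.
      by apply: rc_eqP => k; rewrite !rcZ mulrA divfK.
    by rewrite JZ !ZK.
split; [exact: Pgp|exact: tang|exact: tang|].
rewrite (OmegaP_pairing L_gt0 Pgp (tang _ tV) (tang _ tW)).
rewrite (OmegaP_pairing L_gt0 Pg tV tW).
by apply: pairing_comp; exact: contact_smooth_periodic.
Qed.

End Reparametrization.

Lemma gauge_invariant (T : curve R -> curve R) g V W : gauge L T ->
  inP L g -> tangentP L g V -> tangentP L g W ->
  [/\ inP L (T g), tangentP L (T g) (T V), tangentP L (T g) (T W) &
      OmegaP L (T g) (T V) (T W) = OmegaP L g V W].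
Proof.
move=> gT; elim: gT g V W => {T}
  [theta g V W|f Phi t pf fl g V W|S T _ IHS _ IHT g V W Pg tV tW].
- by apply: rotation_invariant; rewrite -!expr2 cos2Dsin2.
- have [sphi phiL dphi] := flow_diffeo L_gt0 t pf fl.
  exact: reparametrization_invariant.
- have [PT tTV tTW <-] := IHT _ _ _ Pg tV tW.
  exact: IHS.
Qed.

Lemma OmegaQ_invariant (T : curve R -> curve R) g V W : gauge L T ->
  inP L g -> tangentP L g V -> tangentP L g W ->
  [/\ inP L (T g), tangentP L (T g) (T V), tangentP L (T g) (T W) &
      OmegaQ L (T g) (tclass L (T g) (T V)) (tclass L (T g) (T W)) =
      OmegaQ L g (tclass L g V) (tclass L g W)].
Proof.
move=> gT Pg tV tW; have [PT tTV tTW E] := gauge_invariant gT Pg tV tW.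
split; [exact: PT|exact: tTV|exact: tTW|].
rewrite (OmegaQ_tclass L_gt0 PT tTV tTW).
by rewrite (OmegaQ_tclass L_gt0 Pg tV tW).
Qed.

End Gauge.

(** * The symplectic form *)

Section Symplectic.
Context {R : realType}.
Variables (L : R) (L_gt0 : 0 < L).

Section Family.
Variables (n : nat) (G : 'rV[R]_n -> curve R).
Hypothesis fG : Defs.family L G.

Lemma pullbackE j k s : Defs.pullback L (OmegaQ L) G j k s =
  family_form L G (delta_mx 0 j) (delta_mx 0 k) s.
Proof.
have [sG PG] := fG.
apply: (OmegaQ_tclass L_gt0 (PG s)); exact: family_tangent.
Qed.

Lemma pullback_smooth j k : smooth (Defs.pullback L (OmegaQ L) G j k).
Proof.
have [sG PG] := fG; apply: (eq_smooth (fun s => esym (pullbackE j k s))).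
exact: smooth_family_form.
Qed.

Lemma pullback_closed i j k s :
  'D_(delta_mx 0 i) (Defs.pullback L (OmegaQ L) G j k : 'rV[R]_n -> R^o) s
  + 'D_(delta_mx 0 j) (Defs.pullback L (OmegaQ L) G k i : 'rV[R]_n -> R^o) s
  + 'D_(delta_mx 0 k) (Defs.pullback L (OmegaQ L) G i j : 'rV[R]_n -> R^o) s = 0.
Proof.
have [sG PG] := fG.
have E a b v : 'D_v (Defs.pullback L (OmegaQ L) G a b : 'rV[R]_n -> R^o) s =
    'D_v (family_form L G (delta_mx 0 a) (delta_mx 0 b)) s.
  by apply: eq_derive => y; exact: pullbackE.
apply: etrans (congr2 +%R (congr2 +%R (E j k _) (E k i _)) (E i j _)) _.
apply: (family_form_closed L_gt0 sG).
  by move=> s' x; have [_ H _ _ _] := PG s'.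
move=> x; have [_ _ g1 _ gg] := (inPE L _).1 (PG s).
have orth v := tangent_orthogonal (PG s) x (family_tangent sG PG v s).
exact: (detR_orthogonal (g1 x) (gg x).1 (orth _) (orth _) (orth _)).
Qed.

End Family.

Lemma OmegaQ_symplectic : symplectic_form L (OmegaQ L).
Proof.
split.
- exact: (OmegaQ_invariant L_gt0).
- exact: (OmegaQ_linear L_gt0).
- exact: (OmegaQ_skew L_gt0).
- by move=> n G j k fG; exact: pullback_smooth.
- by move=> n G i j k s fG; exact: pullback_closed.
- exact: (OmegaQ_nondegenerate L_gt0).
Qed.

End Symplectic.

(* The first clause says that OmegaQ, defined by picking representatives, is
   given by the integral on all representatives.  The last one is closedness
   at every triple of tangent vectors of P_L, d Omega being the restriction of
   the exterior derivative in the ambient space of maps R -> C^2. *)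
Theorem theorem3p2 (R : realType) (L : R) (hL : 0 < L) :
  [/\ forall g, inP L g ->
        forall A B, tangentQ L g A -> tangentQ L g B ->
        forall V W, A V -> B W -> OmegaQ L g A B = OmegaP L g V W,
      symplectic_form L (OmegaQ L) &
      forall g, inP L g ->
        forall U V W, tangentP L g U -> tangentP L g V -> tangentP L g W ->
        ext_der (OmegaP L) g U V W = 0].
Proof.
split.
- by move=> g Pg A B tA tB V W; exact: (OmegaQ_rep hL Pg tA tB).
- exact: OmegaQ_symplectic.
- by move=> g Pg U V W; exact: ext_der_OmegaP.
Qed.
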